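(* Let $q\ge 4$ and let $H_1$ be a hyperplane of $\mathrm{PG}(U_1)$ with $|H_1\cap\mathcal O_1|=q^2-q+1$. Then $H_1\cap\mathcal O_1$ is a $5$-general set of $H_1\cong\mathrm{PG}(6,q)$.
   Context: $q$ is a prime power. Let $U_1\subset\mathbb F_{q^3}^8$ be the set of vectors $(a,b^{q^2},b^{q},c,b,c^{q},c^{q^2},d)$ with $a,d\in\mathbb F_q$, $b,c\in\mathbb F_{q^3}$; it is an $8$-dimensional $\mathbb F_q$-vector space, so $\mathrm{PG}(U_1)\cong\mathrm{PG}(7,q)$. For $(a,b,c,d)\ne 0$ let $P(a,b,c,d)$ be the point of $\mathrm{PG}(U_1)$ spanned by this vector. Let $\mathcal O_1=\{P(1,t,t^{q^2+q},t^{q^2+q+1}) : t\in\mathbb F_{q^3}\}\cup\{P(0,0,0,1)\}$. For integers $r,s$, an $(r,s)$-set of $\mathrm{PG}(n,q)$ is a set $\mathcal X$ of points such that: (i) every $s$-dimensional projective subspace contains at most $r$ points of $\mathcal X$; (ii) $\mathcal X$ spans $\mathrm{PG}(n,q)$; (iii) some $(s+1)$-dimensional projective subspace contains $r+2$ points of $\mathcal X$. A $k$-general set is a $(k-1,k-2)$-set; so a $5$-general set is a $(4,3)$-set. *)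

(* Defs.v *)
(* F is the field F_{q^3} (any finite field with q^3 elements);
   F_q is realised as the subfield {x | x^q = x} of F. *)
From HB Require Import structures.
From mathcomp Require Import all_boot all_order all_algebra all_field.
Set Implicit Arguments. Unset Strict Implicit. Unset Printing Implicit Defensive.
Import Order.TTheory GRing.Theory.
Local Open Scope ring_scope.

Section PG.
Variables (F : finFieldType) (q : nat).

Definition inFq (x : F) : bool := x ^+ q == x.

Definition vec := 'rV[F]_8.

Definition Kspan (s : seq vec) : {set vec} :=
  [set v | [exists c : {ffun 'I_(size s) -> F},
             [forall i, inFq (c i)] && (v == \sum_(i < size s) c i *: s`_i)]].

Definition Kfree (s : seq vec) : Prop :=
  forall c : 'I_(size s) -> F, (forall i, inFq (c i)) ->
    \sum_(i < size s) c i *: s`_i = 0 -> forall i, c i = 0.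

Definition is_subspace_dim (S : {set vec}) (n : nat) : Prop :=
  exists s : seq vec, [/\ size s = n, Kfree s & S = Kspan s].

Definition vecU (a b c d : F) : vec :=
  \row_(i < 8) [:: a; b ^+ (q ^ 2); b ^+ q; c; b; c ^+ q; c ^+ (q ^ 2); d]`_i.

Definition U1 : {set vec} :=
  [set v | [exists a, exists b, exists c, exists d,
             [&& inFq a, inFq d & v == vecU a b c d]]].

Definition proj_subspace (S : {set vec}) (k : nat) : Prop :=
  is_subspace_dim S k.+1 /\ S \subset U1.

Definition hyperplane (H : {set vec}) : Prop := proj_subspace H 6.

Definition Pt (a b c d : F) : {set vec} := Kspan [:: vecU a b c d].

Definition O1 : {set {set vec}} :=
  [set Pt 1 t (t ^+ (q ^ 2 + q)) (t ^+ (q ^ 2 + q + 1)) | t : F]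
  :|: [set Pt 0 0 0 1].

Definition pts_in (X : {set {set vec}}) (S : {set vec}) : {set {set vec}} :=
  [set P in X | P \subset S].

Definition rs_set (Amb : {set vec}) (X : {set {set vec}}) (r s : nat) : Prop :=
  [/\
      (forall P, P \in X -> P \subset Amb /\ proj_subspace P 0),
      (forall S, proj_subspace S s -> S \subset Amb -> #|pts_in X S| <= r)%N,
      (forall S k, proj_subspace S k -> S \subset Amb ->
         (forall P, P \in X -> P \subset S) -> S = Amb)
    &
      (exists S, [/\ proj_subspace S s.+1, S \subset Amb &
                    (r + 2 <= #|pts_in X S|)%N])].

Definition k_general (Amb : {set vec}) (X : {set {set vec}}) (k : nat) : Prop :=
  rs_set Amb X k.-1 k.-2.

End PG.

(* Main.v *)
(** A hyperplane of PG(U_1) is the zero set of a form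
    f(x, y) = a N(y) + Tr(b x y^(q+q^2)) + Tr(c x^(q+q^2) y) + d N(x)
    with a, d in F_q, and GL(2, q^3) acts on these forms by substitution.

    Five points of O_1 are dependent only if they lie on a common F_q-subline:
    move three of them to infinity, 0, 1, and use that an element outside F_q has
    degree 3. The subline is a twisted cubic, so a hyperplane through four of its
    points contains it, and then f is equivalent to Tr(b t) + Tr(c t^(q+q^2))
    with Tr b = Tr c = 0, which has at least q^2 + 1 zeros.

    For the span: t |-> f(t, 1) is a polynomial, so f has at most q^2 + q + 1 zeros.
    If another form g vanished on the section X of f, then each of the q forms
    g - k f would have at most 2q zeros outside X, which leaves points of O_1
    uncovered.

    For six dependent points: if there were none, X would be the columns of a
    parity-check matrix of a code of redundancy 7 and distance at least 7. This
    violates the sphere-packing bound for q >= 5, and for q = 4 a shortening of it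
    would be a (10, 3)-arc of PG(2, 4). *)
Require Import Defs.
From HB Require Import structures.
From mathcomp Require Import all_boot all_order all_algebra all_field.
From mathcomp Require Import zify ring.
Set Implicit Arguments. Unset Strict Implicit. Unset Printing Implicit Defensive.
Import GRing.Theory.
Local Open Scope ring_scope.

(** * Finite sets, and the numerical sphere-packing inequality *)

Lemma exists_other_mem (T : finType) (B : {set T}) i :
  i \in B -> (1 < #|B|)%N -> exists2 j, j \in B & i != j.
Proof.
move=> iB; rewrite (cardsD1 i) iB ltnS card_gt0 => /set0Pn[j].
by rewrite in_setD1 eq_sym => /andP[ij jB]; exists j.
Qed.

Lemma subset_of_card (T : finType) (B : {set T}) n : (n <= #|B|)%N ->
  exists2 C : {set T}, C \subset B & #|C| = n.
Proof.
move=> leB; have : (0 < #|[set C : {set T} | C \subset B & #|C| == n]|)%N.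
  by rewrite cards_draws bin_gt0.
by rewrite card_gt0 => /set0Pn[C]; rewrite inE => /andP[sCB /eqP cC]; exists C.
Qed.

(** For [n = q] the right side counts the weight-3 vectors of length [q^2 - q + 1] over F_q, and the
    left side the vectors of a hyperplane. With [n = p + 1] and [l + 1 = p (p + 1)] the claim
    reduces to [6 (p + 1)^6 < l (l + 2) p^4]. *)
Lemma packing_bound (n : nat) : (5 <= n)%N -> (n ^ 7 < 'C(n ^ 2 - n + 1, 3) * n.-1 ^ 3)%N.
Proof.
case: n => // p p4; rewrite /= ltnS in p4 *.
have n3 n : ('C(n.+2, 3) * 6 = n.+2 * (n.+1 * n))%N.
  by rewrite -[6%N]/(3`!) bin_ffact !ffactnS ffactn0 /= muln1.
have [l Dl] : exists l, (p * p.+1 = l.+1)%N by exists (p * p.+1).-1; nia.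
have -> : (p.+1 ^ 2 - p.+1 + 1 = l.+2)%N by rewrite expnS expn1; nia.
rewrite -(@ltn_pmul2r 6) // mulnAC n3.
(* This is [4 (p + 1) <= 5 p], valid for [p >= 4], raised to the fourth power. *)
have h1 : (256 * p.+1 ^ 4 <= 625 * p ^ 4)%N.
  by rewrite -[256%N]/(4 ^ 4)%N -[625%N]/(5 ^ 4)%N -!expnMn leq_exp2r //; lia.
pose a := (p ^ 4)%N; pose b := (p.+1 ^ 2)%N.
have b4 : (p.+1 ^ 4 = b * b)%N by rewrite -expnD.
have b_gt : (25 <= b)%N by rewrite -[25%N]/(5 ^ 2)%N leq_exp2r.
have a_gt : (0 < a)%N by rewrite expn_gt0; lia.
have lb : (16 * b <= l.+2 * l + 1)%N.
  have -> : (l.+2 * l + 1 = p ^ 2 * b)%N.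
    by rewrite /b -expnMn Dl expnS expn1; lia.
  by rewrite leq_mul2r -[16%N]/(4 ^ 2)%N leq_exp2r // p4 orbT.
have -> : (p.+1 ^ 7 * 6 = p.+1 * (6 * b * (b * b)))%N.
  by rewrite -b4 /b; ring.
have -> : (l.+2 * (l.+1 * l) * p ^ 3 = p.+1 * ((l.+2 * l) * a))%N.
  by rewrite -Dl /a; ring.
rewrite ltn_pmul2l // -/a -b4.
rewrite b4 -/a in h1 *.
(* [h2] bounds [6 b^3] by [(3750 / 256) a b < 15 a b], while [h3] and [h4] give
   [l (l + 2) a >= 16 a b - a b / 25]. *)
have h2 : (6 * b * (256 * (b * b)) <= 6 * b * (625 * a))%N by rewrite leq_mul2l h1 orbT.
have h3 : (16 * b * a <= (l.+2 * l + 1) * a)%N by rewrite leq_mul2r lb orbT.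
have h4 : (25 * a <= b * a)%N by rewrite leq_mul2r b_gt orbT.
move: h2 h3 h4 a_gt; clear; move: a b => a b; lia.
Qed.

(** * Frobenius, trace and norm of the cubic extension F of F_q *)

Section Cubic.

Variables (F : finFieldType) (q : nat).

Definition frob (x : F) : F := x ^+ q.
Local Notation s := frob.
Local Notation ss x := (frob (frob x)).

Definition Fq : {set F} := [set x | inFq q x].
Definition tr (x : F) : F := x + s x + ss x.
Definition nm (x : F) : F := x * s x * ss x.
(** On U_1 this pairing takes values in F_q, so a vector [w] of U_1 doubles as the linear form of a
    hyperplane; composed with [pvec] it is the form f(x, y). *)
Definition dot (w u : vec F) : F := \sum_i w 0 i * u 0 i.

(* The pair (x, y) of homogeneous coordinates represents the tensor
   (y, x) (x) (y^q, x^q) (x) (y^(q^2), x^(q^2)). *)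
Definition pvec (p : F * F) : vec F :=
  vecU q (nm p.2) (p.1 * s p.2 * ss p.2) (s p.1 * ss p.1 * p.2) (nm p.1).

(** [option F] serves as the projective line over F and parametrises O_1, with [None] for the point
    P(0, 0, 0, 1). *)
Definition rep (o : option F) : F * F := if o is Some t then (t, 1) else (1, 0).
Definition zeros (w : vec F) : {set option F} := [set o | dot w (pvec (rep o)) == 0].

Hypothesis hq : exists p k : nat, prime p /\ q = (p ^ k.+1)%N.
Hypothesis cardF : #|F| = (q ^ 3)%N.
Hypothesis q_ge4 : (4 <= q)%N.

Implicit Types (a b c d x y t k : F) (u v w : vec F) (p : F * F).

Lemma frobD x y : s (x + y) = s x + s y.
Proof.
have [p [k [pr_p Dq]]] := hq; apply: exprDn_pchar.
have pcharFp : p \in [pchar F].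
  by apply: (card_finPcharP _ pr_p (n := k.+1 * 3)); rewrite cardF Dq expnM.
rewrite (eq_pnat _ (pcharf_eq pcharFp)) Dq.
by rewrite pnatX pnat_id.
Qed.

Lemma frobM x y : s (x * y) = s x * s y. Proof. exact: exprMn. Qed.

Lemma frob0 : s 0 = 0.
Proof. by rewrite /frob expr0n; case: q q_ge4. Qed.

Lemma frob1 : s 1 = 1. Proof. exact: expr1n. Qed.

Lemma frobN x : s (- x) = - s x.
Proof. by apply/eqP; rewrite -addr_eq0 addrC -frobD subrr frob0. Qed.

Lemma frobK3 x : s (ss x) = x.
Proof. by rewrite /frob -!exprM -[RHS]expf_card cardF !expnS expn0 muln1 mulnA. Qed.

Lemma frob_eq0 x : (s x == 0) = (x == 0).
Proof. by rewrite /frob expf_eq0; case: q q_ge4. Qed.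

Lemma frob2E x : x ^+ (q ^ 2) = ss x.
Proof. by rewrite /frob -exprM expnS expn1. Qed.

Definition frobE := (frobD, frobM, frobN, frobK3, frob0, frob1).

Lemma FqP x : reflect (s x = x) (x \in Fq).
Proof. by rewrite inE; apply: eqP. Qed.

Lemma Fq_frob x : x \in Fq -> s x = x. Proof. by move/FqP. Qed.

Lemma Fq0 : 0 \in Fq. Proof. by apply/FqP/frob0. Qed.
Lemma Fq1 : 1 \in Fq. Proof. by apply/FqP/frob1. Qed.
Lemma FqD x y : x \in Fq -> y \in Fq -> x + y \in Fq.
Proof. by move=> /FqP Kx /FqP Ky; apply/FqP; rewrite frobD Kx Ky. Qed.
Lemma FqN x : x \in Fq -> - x \in Fq.
Proof. by move=> /FqP Kx; apply/FqP; rewrite frobN Kx. Qed.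
Lemma FqB x y : x \in Fq -> y \in Fq -> x - y \in Fq.
Proof. by move=> Kx Ky; rewrite FqD ?FqN. Qed.
Lemma FqM x y : x \in Fq -> y \in Fq -> x * y \in Fq.
Proof. by move=> /FqP Kx /FqP Ky; apply/FqP; rewrite frobM Kx Ky. Qed.
Lemma FqV x : x \in Fq -> x^-1 \in Fq.
Proof. by move=> /FqP Kx; apply/FqP; rewrite /frob exprVn; congr _^-1. Qed.

Lemma tr_Fq x : tr x \in Fq.
Proof. by apply/FqP; rewrite /tr !frobE; ring. Qed.
Lemma nm_Fq x : nm x \in Fq.
Proof. by apply/FqP; rewrite /nm !frobE; ring. Qed.

Lemma trD x y : tr (x + y) = tr x + tr y.
Proof. by rewrite /tr !frobE; ring. Qed.
Lemma trN x : tr (- x) = - tr x.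
Proof. by rewrite /tr !frobE; ring. Qed.
Lemma trZ k x : k \in Fq -> tr (k * x) = k * tr x.
Proof. by move/Fq_frob=> Kk; rewrite /tr !frobE !Kk; ring. Qed.
Lemma tr0 : tr 0 = 0. Proof. by rewrite /tr !frob0 !addr0. Qed.
Lemma nm_eq0 x : (nm x == 0) = (x == 0).
Proof. by rewrite /nm !mulf_eq0 !frob_eq0 !orbb. Qed.
Lemma nm0 : nm 0 = 0. Proof. by apply/eqP; rewrite nm_eq0. Qed.
Lemma nm1 : nm 1 = 1. Proof. by rewrite /nm !frob1 !mul1r. Qed.

(** * The pairing and the F_q-space U_1 in coordinates *)

Lemma dotD w u v : dot w (u + v) = dot w u + dot w v.
Proof.
rewrite /dot -big_split; apply: eq_bigr => i _ /=.
by rewrite !mxE mulrDr.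
Qed.
Lemma dotZ w k u : dot w (k *: u) = k * dot w u.
Proof.
rewrite /dot mulr_sumr; apply: eq_bigr => i _ /=.
by rewrite !mxE mulrCA.
Qed.
Lemma dotC w u : dot w u = dot u w.
Proof. by apply: eq_bigr => i _; rewrite mulrC. Qed.
Lemma dotDl w w' u : dot (w + w') u = dot w u + dot w' u.
Proof. by rewrite !(dotC _ u) dotD. Qed.
Lemma dotZl k w u : dot (k *: w) u = k * dot w u.
Proof. by rewrite !(dotC _ u) dotZ. Qed.
Lemma dot0 w : dot w 0 = 0.
Proof. by rewrite -(scale0r 0) dotZ mul0r. Qed.
Lemma dot_sum w (I : finType) (c : I -> F) (v : I -> vec F) :
  dot w (\sum_i c i *: v i) = \sum_i c i * dot w (v i).
Proof.
by rewrite (big_morph (dot w) (dotD w) (dot0 w)); apply: eq_bigr => i _; rewrite dotZ.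
Qed.

Lemma dot_vecU a b c d (a' b' c' d' : F) :
  dot (vecU q a b c d) (vecU q a' b' c' d') =
  a * a' + tr (b * b') + tr (c * c') + d * d'.
Proof.
rewrite /dot !big_ord_recl big_ord0 !mxE /= !frob2E -!/(frob _) /tr !frobM.
ring.
Qed.

Lemma U1P (u : vec F) : reflect (exists a b c d,
  [/\ a \in Fq, d \in Fq & u = vecU q a b c d]) (u \in U1 F q).
Proof.
apply: (iffP idP) => [|[a [b [c [d [Ka Kd ->]]]]]].
  rewrite inE => /existsP[a /existsP[b /existsP[c /existsP[d /and3P[Ka Kd /eqP->]]]]].
  by exists a, b, c, d; rewrite !inE.
rewrite inE; apply/existsP; exists a; apply/existsP; exists b.
apply/existsP; exists c; apply/existsP; exists d.
by move: Ka Kd; rewrite !inE eqxx => -> ->.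
Qed.

Lemma vecU_U1 a b c d : a \in Fq -> d \in Fq -> vecU q a b c d \in U1 F q.
Proof. by move=> Ka Kd; apply/U1P; exists a, b, c, d. Qed.

Lemma vecU_D a b c d (a' b' c' d' : F) :
  vecU q a b c d + vecU q a' b' c' d' = vecU q (a + a') (b + b') (c + c') (d + d').
Proof.
apply/rowP => i; rewrite !mxE !frob2E -!/(frob _) !frobD.
by case: i => [[|[|[|[|[|[|[|[|i]]]]]]]] lti] //=.
Qed.

Lemma vecU_Z k a b c d : k \in Fq ->
  k *: vecU q a b c d = vecU q (k * a) (k * b) (k * c) (k * d).
Proof.
move/Fq_frob=> Kk; apply/rowP => i; rewrite !mxE !frob2E -!/(frob _) !frobM !Kk.
by case: i => [[|[|[|[|[|[|[|[|i]]]]]]]] lti].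
Qed.

Lemma vecU0 : vecU q 0 0 0 0 = 0 :> vec F.
Proof.
apply/rowP => i; rewrite !mxE !frob2E -!/(frob _) !frob0.
by case: i => [[|[|[|[|[|[|[|[|i]]]]]]]] lti].
Qed.

Lemma vecU_inj a b c d (a' b' c' d' : F) :
  vecU q a b c d = vecU q a' b' c' d' -> [/\ a = a', b = b', c = c' & d = d'].
Proof.
move/rowP=> E; split.
(* Positions 0, 4, 3 and 7 hold a, b, c and d without a Frobenius twist. *)
- by have := E (inord 0); rewrite !mxE inordK.
- by have := E (inord 4); rewrite !mxE inordK.
- by have := E (inord 3); rewrite !mxE inordK.
- by have := E (inord 7); rewrite !mxE inordK.
Qed.

Lemma U1_0 : 0 \in U1 F q. Proof. by rewrite -vecU0 vecU_U1 ?Fq0. Qed.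
Lemma U1_D u v : u \in U1 F q -> v \in U1 F q -> u + v \in U1 F q.
Proof.
move=> /U1P[a [b [c [d [Ka Kd ->]]]]] /U1P[a' [b' [c' [d' [Ka' Kd' ->]]]]].
by rewrite vecU_D vecU_U1 ?FqD.
Qed.
Lemma U1_Z k u : k \in Fq -> u \in U1 F q -> k *: u \in U1 F q.
Proof.
by move=> Kk /U1P[a [b [c [d [Ka Kd ->]]]]]; rewrite vecU_Z ?vecU_U1 ?FqM.
Qed.
Lemma dot_Fq w u : w \in U1 F q -> u \in U1 F q -> dot w u \in Fq.
Proof.
move=> /U1P[a [b [c [d [Ka Kd ->]]]]] /U1P[a' [b' [c' [d' [Ka' Kd' ->]]]]].
by rewrite dot_vecU (FqD (FqD (FqD (FqM Ka Ka') (tr_Fq _)) (tr_Fq _)) (FqM Kd Kd')).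
Qed.

Lemma pvec_U1 p : pvec p \in U1 F q.
Proof. by rewrite vecU_U1 ?nm_Fq. Qed.

Lemma dot_pvec a b c d x y : dot (vecU q a b c d) (pvec (x, y)) =
  a * nm y + tr (b * (x * s y * ss y)) + tr (c * (s x * ss x * y)) + d * nm x.
Proof. exact: dot_vecU. Qed.

Lemma pvecZ k x y : pvec (k * x, k * y) = nm k *: pvec (x, y).
Proof.
by rewrite /pvec vecU_Z ?nm_Fq //=; congr vecU; rewrite /nm !frobE; ring.
Qed.

(** * Root counts: trace fibres, the subfield F_q, zeros of a form *)

Lemma card_roots (p : {poly F}) (A : {set F}) n :
  (size p <= n.+1)%N -> p != 0 -> {in A, forall x, root p x} -> (#|A| <= n)%N.
Proof.
move=> sz p0 rA; have := max_poly_roots p0 (rs := enum A).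
rewrite enum_uniq cardE => /(_ _ isT) lt; rewrite -ltnS; apply: leq_trans sz.
by apply: lt; apply/allP => x; rewrite mem_enum => /rA.
Qed.

Lemma q_sqr : (4 * q <= q ^ 2)%N.
Proof. by rewrite expnS expn1 leq_mul2r q_ge4 orbT. Qed.

Lemma card_tr_fiber k : (#|[set x | tr x == k]| <= q ^ 2)%N.
Proof.
have q2 := q_sqr; have q4 := q_ge4.
pose p : {poly F} := 'X^(q ^ 2) + 'X^q + 'X - k%:P.
apply: (@card_roots p).
- rewrite /p; apply: (leq_trans (size_polyD _ _)).
  rewrite geq_max size_polyN (leq_trans (size_polyC_leq1 _)) // andbT.
  apply: (leq_trans (size_polyD _ _)); rewrite geq_max size_polyX.
  apply/andP; split; last by lia.
  apply: (leq_trans (size_polyD _ _)); rewrite geq_max !size_polyXn.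
  by apply/andP; split; lia.
- apply/eqP => /(congr1 (fun r : {poly F} => r`_1)).
  rewrite !coefE /=.
  have -> : (1 == q ^ 2)%N = false by lia.
  have -> : (1 == q)%N = false by lia.
  by rewrite !add0r subr0 => /eqP; rewrite oner_eq0.
move=> x; rewrite inE => /eqP Ex; rewrite /root !hornerE.
by rewrite frob2E -/(frob x) -Ex /tr; apply/eqP; ring.
Qed.

(** The roots of [X^q - X] give the upper bound. For the lower bound, the trace maps F into F_q with
    fibres of size at most [q^2], so [q^3 <= q^2 |F_q|]. *)
Lemma cardFq : #|Fq| = q.
Proof.
have q2 := q_sqr; have q4 := q_ge4.
apply/eqP; rewrite eqn_leq; apply/andP; split.
  apply: (@card_roots ('X^q - 'X)).
  - apply: (leq_trans (size_polyD _ _)); rewrite geq_max size_polyN size_polyX.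
    by rewrite size_polyXn; lia.
  - apply/eqP => /(congr1 (fun r : {poly F} => r`_1)).
    rewrite !coefE /=.
    have -> : (1 == q)%N = false by lia.
    by move/eqP; rewrite add0r oppr_eq0 oner_eq0.
  by move=> x /FqP Ex; rewrite /root !hornerE -/(frob x) Ex subrr.
rewrite -(@leq_pmul2r (q ^ 2)); last by lia.
rewrite -expnS -cardF -cardsT -sum1_card.
rewrite (partition_big tr (mem Fq)) /=; last by move=> x _; apply: tr_Fq.
rewrite -sum_nat_const; apply: leq_sum => k _.
rewrite sum1_card (eq_card (B := [set x | tr x == k])) ?card_tr_fiber // => x.
by rewrite unfold_in /= !inE.
Qed.

(** The form f(t, 1) with all conjugates written as powers of t. The exponents are the subset sums
    of {1, q, q^2}; they are distinct, so each of a, b, c, d can be read off as a coefficient. *)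
Definition upoly (a b c d : F) : {poly F} :=
  a *: 'X^0 + b *: 'X^1 + s b *: 'X^q + ss b *: 'X^(q ^ 2)
  + ss c *: 'X^(q + 1) + s c *: 'X^(q ^ 2 + 1) + c *: 'X^(q ^ 2 + q)
  + d *: 'X^(q ^ 2 + q + 1).

Lemma size_upoly a b c d : (size (upoly a b c d) <= (q ^ 2 + q + (d != 0%R)).+1)%N.
Proof.
have q2 := q_sqr; have q4 := q_ge4.
apply/leq_sizeP => j ltj; rewrite /upoly !coefE.
have nz (x : F) i : (i <= q ^ 2 + q)%N -> x * (j == i)%:R = 0.
  by move=> lei; rewrite (_ : (j == i) = false) ?mulr0 //; lia.
rewrite (nz _ 0)%N ?(nz _ 1)%N ?(nz _ q) ?(nz _ (q ^ 2)%N) ?(nz _ (q + 1)%N)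
  ?(nz _ (q ^ 2 + 1)%N) ?(nz _ (q ^ 2 + q)%N) ?addr0 ?add0r; do ?lia.
have [->|d0] := eqVneq d 0; first by rewrite mul0r.
rewrite d0 in ltj.
by rewrite [(j == _)%N](_ : _ = false) ?mulr0 //; lia.
Qed.

Lemma upoly_eq0 a b c d :
  upoly a b c d = 0 -> [/\ a = 0, b = 0, c = 0 & d = 0].
Proof.
have q2 := q_sqr; have q4 := q_ge4.
move=> E; have C j := congr1 (fun r : {poly F} => r`_j) E.
have nz (x : F) (i j : nat) : (i == j)%N = false -> x * (i == j)%:R = 0.
  by move=> ->; rewrite mulr0.
split; [have := C 0%N|have := C 1%N|have := C (q^2+q)%N|have := C (q^2+q+1)%N];
  rewrite /upoly !coefE ?eqxx ?mulr1; do ![rewrite nz ?addr0 ?add0r; last by lia]; by [].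
Qed.

Lemma horner_upoly a b c d t :
  (upoly a b c d).[t] = dot (vecU q a b c d) (pvec (t, 1)).
Proof.
rewrite /upoly !hornerE !exprD !expr1 !frob2E -/(frob t) dot_pvec nm1 /tr !frobE /nm.
ring.
Qed.

(** The polynomial f(t, 1) has degree at most [q^2 + q + 1], and at most [q^2 + q] if [d = 0]; the
    point at infinity is a zero exactly in the latter case. *)
Lemma card_zeros w : w \in U1 F q -> w != 0 -> (#|zeros w| <= q ^ 2 + q + 1)%N.
Proof.
move=> /U1P[a [b [c [d [Ka Kd ->]]]]] w0.
set f := vecU q a b c d in w0 *.
have le1 : (#|[set t : F | dot f (pvec (t, 1%R)) == 0%R]| <= q ^ 2 + q + (d != 0%R))%N.
  apply: (card_roots (size_upoly a b c d)).
    by apply: contraNneq w0 => /upoly_eq0[a0 b0 c0 d0]; rewrite /f a0 b0 c0 d0 vecU0.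
  by move=> t; rewrite inE /root horner_upoly.
have dN : dot f (pvec (rep None)) = d.
  by rewrite dot_pvec /tr !(nm0, nm1, frobE); ring.
have sub : zeros f \subset
    (if d == 0 then [set None] else set0) :|: Some @: [set t | dot f (pvec (t, 1)) == 0].
  apply/subsetP => -[t|]; rewrite inE in_setU => Z.
    by apply/orP; right; apply: imset_f; rewrite inE.
  by rewrite dN in Z; rewrite Z inE eqxx.
apply: (leq_trans (subset_leq_card sub)).
apply: (leq_trans (leq_card_setU _ _)).
rewrite card_imset; last by move=> x y [].
by case: (d =P 0) le1 => _ /=; rewrite ?cards1 ?cards0 => le1; lia.
Qed.


(** If [z] were nonzero, the form with [b = z] and other coefficients 0 would take the values Tr(b'
    z) = 0 at all [q^3] affine points, more than [card_zeros] allows. *)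
Lemma tr_nondeg z : (forall b, tr (b * z) = 0) -> z = 0.
Proof.
move=> Z; apply/eqP/negPn/negP => z0; have q2 := q_sqr.
have Uw : vecU q 0 z 0 0 \in U1 F q by rewrite vecU_U1 ?Fq0.
have w0 : vecU q 0 z 0 0 != 0 :> vec F.
  apply: contraNneq z0; rewrite -vecU0.
  by move/vecU_inj => [_ ->].
have := card_zeros Uw w0; rewrite leqNgt => /negP; apply.
have sub : Some @: [set: F] \subset zeros (vecU q 0 z 0 0).
  apply/subsetP => _ /imsetP[t _ ->]; rewrite inE dot_pvec //.
  rewrite (_ : z * _ = t * z); last by rewrite !frobE; ring.
  by rewrite Z !mul0r tr0 !addr0.
apply: leq_trans (subset_leq_card sub).
rewrite card_imset ?cardsT ?cardF; last by move=> x y [].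
have q4 := q_ge4; by rewrite (expnS q 2); nia.
Qed.

(** The conjugates of [t] are three distinct roots of the quadratic, so its divided differences at
    them vanish; this kills [A], then [B], then [C]. *)
Lemma quadratic_indep t A B C : t \notin Fq -> A \in Fq -> B \in Fq -> C \in Fq ->
  A * (t * t) + B * t + C = 0 -> [/\ A = 0, B = 0 & C = 0].
Proof.
move=> Kt /Fq_frob KA /Fq_frob KB /Fq_frob KC E0.
have E1 := congr1 s E0; have E2 := congr1 s E1.
rewrite !frobE !(KA, KB, KC) in E1 E2.
have n01 : t - s t != 0.
  by rewrite subr_eq0; apply: contra Kt => /eqP Et; apply/FqP.
have n12 : s t - ss t != 0.
  by rewrite -frobN -frobD // frob_eq0.
have n20 : t - ss t != 0.
  by rewrite -[t in t - _]frobK3 -frobN -frobD // !frob_eq0 // -oppr_eq0 opprB.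
have e01 : A * (t + s t) + B = 0.
  by apply: (mulIf n01); rewrite mul0r -(subrr 0) -{1}E0 -E1; ring.
have e12 : A * (s t + ss t) + B = 0.
  by apply: (mulIf n12); rewrite mul0r -(subrr 0) -{1}E1 -E2; ring.
have A0 : A = 0.
  by apply: (mulIf n20); rewrite mul0r -(subrr 0) -{1}e01 -e12; ring.
have B0 : B = 0 by rewrite A0 mul0r add0r in e01.
by split=> //; rewrite A0 B0 !mul0r !add0r in E0.
Qed.

(** * Linear substitutions, and relations among five points in standard position *)

Lemma moebius_form w a b c d : w \in U1 F q ->
  exists2 w', w' \in U1 F q & forall x y,
    dot w' (pvec (x, y)) = dot w (pvec (a * x + b * y, c * x + d * y)).
Proof.
move=> /U1P[A [B [C [D [KA KD ->]]]]].
(* Expand the form after substitution. The outer coefficients are its values at (0, 1) and (1, 0);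
   the inner ones collect the terms in [x y^(q+q^2)] and in [x^(q+q^2) y], the other mixed terms
   being their conjugates. *)
exists (vecU q
  (A * nm d + tr (B * (b * s d * ss d)) + tr (C * (s b * ss b * d)) + D * nm b)
  (A * (c * s d * ss d)
   + (B * a * s d * ss d + s B * s b * ss d * c + ss B * ss b * c * s d)
   + (C * s b * ss b * c + s C * ss b * a * s d + ss C * a * s b * ss d)
   + D * (a * s b * ss b))
  (A * (d * s c * ss c)
   + (B * b * s c * ss c + s B * s a * ss c * d + ss B * ss a * d * s c)
   + (C * s a * ss a * d + s C * ss a * b * s c + ss C * b * s a * ss c)
   + D * (b * s a * ss a))
  (A * nm c + tr (B * (a * s c * ss c)) + tr (C * (s a * ss a * c)) + D * nm a)).
  by rewrite vecU_U1 // (FqD (FqD (FqD (FqM KA (nm_Fq _)) (tr_Fq _)) (tr_Fq _))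
       (FqM KD (nm_Fq _))).
move=> x y; rewrite !dot_pvec /tr /nm !frobE !(Fq_frob KA) !(Fq_frob KD).
ring.
Qed.

(** The points are infinity, 0, 1, [t], [u]. Testing the relation against each coordinate of [w]
    separately gives four equations; eliminating [u] leaves a quadratic for [t] over F_q, whose
    coefficients vanish when [t] is outside F_q. *)
Lemma five_std_dep t (u c1 c2 c3 c4 c5 : F) :
  c3 \in Fq -> c4 \in Fq -> c5 \in Fq ->
  t != 0 -> u != 0 -> u != 1 -> t != u ->
  (forall w, w \in U1 F q ->
     c1 * dot w (pvec (1, 0)) + c2 * dot w (pvec (0, 1)) + c3 * dot w (pvec (1, 1))
     + c4 * dot w (pvec (t, 1)) + c5 * dot w (pvec (u, 1)) = 0) ->
  t \in Fq \/ [/\ c1 = 0, c2 = 0, c3 = 0, c4 = 0 & c5 = 0].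
Proof.
move=> K3 K4 K5 t0 u0 u1 tu Dep.
have Eb : c3 + c4 * t + c5 * u = 0.
  apply: tr_nondeg => b; have := Dep (vecU q 0 b 0 0).
  rewrite vecU_U1 ?Fq0 // => /(_ isT) <-.
  by rewrite !dot_pvec /nm /tr !frobE !(Fq_frob K3, Fq_frob K4, Fq_frob K5); ring.
have Ec : c3 + c4 * (s t * ss t) + c5 * (s u * ss u) = 0.
  apply: tr_nondeg => b; have := Dep (vecU q 0 0 b 0).
  rewrite vecU_U1 ?Fq0 // => /(_ isT) <-.
  by rewrite !dot_pvec /nm /tr !frobE !(Fq_frob K3, Fq_frob K4, Fq_frob K5); ring.
have Ea : c2 + c3 + c4 + c5 = 0.
  have := Dep (vecU q 1 0 0 0); rewrite vecU_U1 ?Fq0 ?Fq1 // => /(_ isT) <-.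
  by rewrite !dot_pvec !(nm0, nm1, mulr0, mul0r, mulr1, mul1r, tr0, add0r, addr0).
have Ed : c1 + c3 + c4 * nm t + c5 * nm u = 0.
  have := Dep (vecU q 0 0 0 1); rewrite vecU_U1 ?Fq0 ?Fq1 // => /(_ isT) <-.
  by rewrite !dot_pvec !(nm0, nm1, mulr0, mul0r, mulr1, mul1r, tr0, add0r, addr0).
have [Kt|Kt] := boolP (t \in Fq); [by left | right].
suff [Z3 Z4 Z5] : [/\ c3 = 0, c4 = 0 & c5 = 0].
  by split=> //; [move: Ed | move: Ea]; rewrite Z3 Z4 Z5 ?mul0r !addr0.
(* Multiply [Ec] by [c5 t] and replace the conjugates of [c5 u] using those of [Eb]. *)
have Eq : - (c3 * c4) * (t * t) + (c3 * c5 + c3 * c3 + c3 * c4 * tr t) * t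
          + c4 * (c4 + c5) * nm t = 0.
  have E1 := congr1 s Eb; have E2 := congr1 s E1.
  rewrite !frobE !(Fq_frob K3, Fq_frob K4, Fq_frob K5) in E1 E2.
  have S1 : c5 * s u = - (c3 + c4 * s t) by apply/eqP; rewrite -addr_eq0 addrC E1.
  have S2 : c5 * ss u = - (c3 + c4 * ss t) by apply/eqP; rewrite -addr_eq0 addrC E2.
  transitivity (t * (c5 * (c3 + c4 * (s t * ss t)) + (c5 * s u) * (c5 * ss u))).
    by rewrite S1 S2 /tr /nm; ring.
  transitivity (t * c5 * (c3 + c4 * (s t * ss t) + c5 * (s u * ss u))); first by ring.
  by rewrite Ec mulr0.
have [||| c34 E4 E5] := quadratic_indep Kt _ _ _ Eq.
- by rewrite FqN ?FqM.
- by rewrite !FqD ?FqM ?tr_Fq.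
- by rewrite FqM ?nm_Fq ?FqM ?FqD.
(* If [c4 = 0], a nonzero [c3] would force [c5 = - c3] and [u = 1]. Otherwise [c3 = 0] and
   [c5 = - c4], which forces [t = u]. *)
have [c40|c40] := eqVneq c4 0.
  rewrite c40 mulr0 mul0r addr0 -mulrDr in E4; rewrite c40 mul0r addr0 in Eb.
  have [c30|c30] := eqVneq c3 0.
    split=> //; apply/eqP; move/eqP: Eb.
    by rewrite c30 add0r mulf_eq0 (negPf u0) orbF.
  move/eqP: E4; rewrite mulf_eq0 (negPf c30) addr_eq0 => /eqP c5E.
  have /eqP : c3 * (1 - u) = 0 by rewrite -Eb c5E; ring.
  by rewrite mulf_eq0 (negPf c30) subr_eq0 eq_sym (negPf u1).
move/eqP: c34; rewrite oppr_eq0 mulf_eq0 (negPf c40) orbF => /eqP c30.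
move/eqP: E5; rewrite 2!mulf_eq0 (negPf c40) nm_eq0 (negPf t0) orbF addrC addr_eq0 => /eqP c5E.
move/eqP: Eb; rewrite c30 add0r c5E mulNr -mulrBr mulf_eq0 (negPf c40) subr_eq0.
by rewrite (negPf tu).
Qed.

(** * Kernels of t |-> Tr(b t), and forms vanishing on the subline of F_q *)

Lemma card_tr_mul_fiber b k :
  (#|[set t | tr (b * t)%R == k]| <= #|[set t | tr (b * t)%R == 0%R]|)%N.
Proof.
case: (set_0Vmem [set t | tr (b * t) == k]) => [->|[t0 Zt0]]; first by rewrite cards0.
move: Zt0; rewrite inE => /eqP Et0; rewrite -(card_imset _ (addIr (- t0))).
apply/subset_leq_card/subsetP => _ /imsetP[t Zt ->].
by move: Zt; rewrite !inE => /eqP Et; rewrite mulrBr trD trN Et Et0 subrr.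
Qed.

(** At most q fibres cover the [q^3] elements of F, and none is larger than the kernel. *)
Lemma card_tr_kernel_ge b : (q ^ 2 <= #|[set t | tr (b * t)%R == 0%R]|)%N.
Proof.
have q4 := q_ge4; rewrite -(@leq_pmul2l q); last by lia.
rewrite -expnS -cardF -cardsT -sum1_card.
rewrite (partition_big (fun t => tr (b * t)) (mem Fq)) /=; last by move=> x _; apply: tr_Fq.
rewrite -cardFq -sum_nat_const; apply: leq_sum => k _.
rewrite sum1_card (eq_card (B := [set x | tr (b * x) == k])) ?card_tr_mul_fiber // => x.
by rewrite unfold_in /= !inE.
Qed.

Lemma card_tr_kernel_le b : b != 0 -> (#|[set t | tr (b * t)%R == 0%R]| <= q ^ 2)%N.
Proof.
move=> b0; apply: leq_trans (card_tr_fiber 0).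
rewrite -(card_imset _ (mulfI b0)); apply/subset_leq_card/subsetP.
by move=> _ /imsetP[t Zt ->]; move: Zt; rewrite !inE.
Qed.

(* f(t + m) = f(t) - m tr(c t) for m in F_q, so each coset t + F_q with
   tr(c t) <> 0 contains exactly one zero of f. *)
Lemma card_zeros_subline b c : tr b = 0 -> tr c = 0 ->
  (q ^ 2 + 1 <= #|zeros (vecU q 0%R b c 0%R)|)%N.
Proof.
move=> b0 c0; have q4 := q_ge4; have q2 := q_sqr.
pose f t := dot (vecU q 0 b c 0) (pvec (t, 1)).
have fE t : f t = tr (b * t) + tr (c * (s t * ss t)).
  by rewrite /f dot_pvec /tr /nm !frobE; ring.
pose Z := [set t | f t == 0].
(* The one extra zero is the point at infinity. *)
suff leZ : (q ^ 2 <= #|Z|)%N.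
  apply: (@leq_trans #|None |: Some @: Z|).
    rewrite cardsU1 card_imset; last by move=> x y [].
    suff -> : None \notin Some @: Z by lia.
    by apply/imsetP => -[].
  apply/subset_leq_card/subsetP => o; rewrite !inE => /orP[/eqP->|/imsetP[t tZ ->]].
    by rewrite dot_pvec /tr /nm !frobE; apply/eqP; ring.
  by move: tZ; rewrite inE.
have [c_eq0|c_neq0] := eqVneq c 0.
  apply: leq_trans (card_tr_kernel_ge b) _; apply/subset_leq_card/subsetP => t.
  by rewrite !inE fE c_eq0 mul0r tr0 addr0.
pose ker := [set t | tr (c * t) == 0].
pose Z1 := Z :\: ker.
(* Each t outside [ker] is an element of [Z1] plus an element of F_q, so [q^3 - |ker| <= q |Z1|] and
   hence [|Z1| >= q^2 - q]. *)
have leN : (#|~: ker| <= #|Z1| * q)%N.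
  rewrite -cardFq -cardsX.
  apply: leq_trans (leq_imset_card (fun z : F * F => z.1 + z.2) (mem (setX Z1 Fq))).
  apply/subset_leq_card/subsetP => t; rewrite !inE => kt.
  have [m Km mE] : exists2 m, m \in Fq & m * tr (c * t) = f t.
    by exists (f t / tr (c * t)); rewrite ?divfK // FqM ?FqV ?tr_Fq // fE FqD ?tr_Fq.
  apply/imsetP; exists (t + m, - m); last by rewrite /= addrK.
  have trm : tr (c * (t + m)) = tr (c * t).
    by rewrite mulrDr trD (mulrC c m) (trZ _ Km) c0 mulr0 addr0.
  rewrite in_setX /= (FqN Km) andbT !inE trm kt /=.
  suff -> : f (t + m) = f t - m * tr (c * t).
    by rewrite mE subrr.
  have E0 : m * tr b + (m * tr t + m ^+ 2) * tr c = 0 by rewrite b0 c0 !mulr0 addr0.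
  by rewrite -[RHS]addr0 -E0 !fE /tr !frobE !(Fq_frob Km); ring.
have leker := card_tr_kernel_le c_neq0.
have := cardsC ker; rewrite cardF => cC.
(* The elements of F_q are zeros of [f] inside [ker], hence outside [Z1]; they supply the remaining
   q zeros. *)
have sub : (Z1 :|: Fq) \subset Z.
  rewrite subUset subsetDl /=; apply/subsetP => t Kt; rewrite inE fE.
  rewrite !(Fq_frob Kt) (mulrC b) (trZ _ Kt) b0 (mulrC c) (trZ _ (FqM Kt Kt)) c0.
  by rewrite !mulr0 addr0.
have dis : Z1 :&: Fq = set0.
  apply/setP => t; rewrite in_set0 in_setI; apply/negP => /andP[].
  rewrite 2!inE => /andP[kt _] Kt; move: kt.
  by rewrite ?inE (mulrC c) (trZ _ Kt) c0 mulr0 eqxx.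
have := subset_leq_card sub; rewrite cardsU dis cards0 cardFq subn0.
rewrite -/ker in leker; rewrite (expnS q 2) in cC.
have : (q * (q ^ 2 - q) <= q * #|Z1|)%N.
  by rewrite mulnBr -{3}(expn1 q) -expnS; lia.
by rewrite leq_pmul2l; lia.
Qed.

(** * Projective maps of the line over F, and five dependent points of O_1 *)

Definition det2 p (r : F * F) : F := p.1 * r.2 - r.1 * p.2.

Lemma det2_rep (o o' : option F) : o != o' -> det2 (rep o) (rep o') != 0.
Proof.
case: o o' => [t|] [u|] //=; rewrite /det2 /= ?(mul0r, mulr1, mul1r, mulr0, subr0, sub0r).
- by move=> tu; rewrite subr_eq0; apply: contraNneq tu => ->.
- by rewrite oppr_eq0 oner_eq0.
- by rewrite oner_eq0.
Qed.

Definition point_class p : option F := if p.2 == 0 then None else Some (p.1 / p.2).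

Lemma pvec_class p : p != (0, 0) ->
  exists2 k, k != 0 & p = (k * (rep (point_class p)).1, k * (rep (point_class p)).2).
Proof.
case: p => x y; rewrite /point_class /= xpair_eqE; have [->|y0] := eqVneq y 0.
  by rewrite andbT => x0; exists x; rewrite // mulr1 mulr0.
by move=> _; exists y; rewrite //= mulr1 mulrC divfK.
Qed.

(** The substitution multiplies [det2] by its nonzero determinant, so it keeps distinct points
    distinct and embeds the zeros of [w'] into those of [w]. *)
Lemma zeros_moebius_le w w' a b c d : a * d - b * c != 0 ->
  (forall x y, dot w' (pvec (x, y)) = dot w (pvec (a * x + b * y, c * x + d * y))) ->
  (#|zeros w'| <= #|zeros w|)%N.
Proof.
move=> D0 ww'.
pose M p : F * F := (a * p.1 + b * p.2, c * p.1 + d * p.2).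
have M0 o : M (rep o) != (0, 0).
  apply: contraNneq D0 => -[E1 E2]; case: o E1 E2 => [t|] /=; rewrite ?mulr1 ?mulr0 ?addr0.
    move=> /eqP; rewrite addrC addr_eq0 => /eqP-> /eqP; rewrite addrC addr_eq0 => /eqP->.
    by apply/eqP; ring.
  by move=> -> ->; rewrite mul0r mulr0 subr0.
rewrite -(card_in_imset (f := fun o => point_class (M (rep o)))); last first.
  move=> o o' _ _ /= E; apply/eqP/negPn/negP => /det2_rep.
  have [k k0 Ek] := pvec_class (M0 o); have [k' k0' Ek'] := pvec_class (M0 o').
  rewrite -E in Ek'; case/negP; rewrite -(mulrI_eq0 _ (mulfI D0)).
  have -> : (a * d - b * c) * det2 (rep o) (rep o') = det2 (M (rep o)) (M (rep o')).
    by rewrite /det2 /M /=; ring.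
  by rewrite Ek Ek' /det2 /=; apply/eqP; ring.
apply/subset_leq_card/subsetP => _ /imsetP[o Zo ->]; move: Zo; rewrite !inE.
have [k k0 Ek] := pvec_class (M0 o).
have -> : dot w' (pvec (rep o)) = dot w (pvec (M (rep o))).
  by rewrite [rep o]surjective_pairing ww'.
set o' := point_class _ in Ek *.
by rewrite Ek pvecZ dotZ mulf_eq0 nm_eq0 (negPf k0) -surjective_pairing.
Qed.

(** A projective map takes the first three points to infinity, 0, 1 and the others to [t], [u]. By
    [five_std_dep] a nontrivial relation puts [t] in F_q; the transported form then vanishes on the
    whole subline, and [card_zeros_subline] applies. *)
Lemma card_zeros_five_dep w (o1 o2 o3 o4 o5 : option F) (c1 c2 c3 c4 c5 : F) :
  w \in U1 F q -> uniq [:: o1; o2; o3; o4; o5] ->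
  [&& o1 \in zeros w, o2 \in zeros w, o3 \in zeros w & o4 \in zeros w] ->
  [/\ c3 \in Fq, c4 \in Fq & c5 \in Fq] ->
  c1 *: pvec (rep o1) + c2 *: pvec (rep o2) + c3 *: pvec (rep o3)
    + c4 *: pvec (rep o4) + c5 *: pvec (rep o5) = 0 ->
  [/\ c1 = 0, c2 = 0, c3 = 0, c4 = 0 & c5 = 0] \/ (q ^ 2 + 1 <= #|zeros w|)%N.
Proof.
move=> Uw oU oZ [K3 K4 K5] dep; move: oU oZ; rewrite /= !inE !negb_or andbT.
move=> /and4P[/and4P[n12 n13 n14 n15] /and3P[n23 n24 n25] /andP[n34 n35] n45].
move=> /and4P[/eqP z1 /eqP z2 /eqP z3 /eqP z4].
have := (det2_rep n12, det2_rep n13, det2_rep n14, det2_rep n15, det2_rep n23).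
have := (det2_rep n24, det2_rep n25, det2_rep n34, det2_rep n35, det2_rep n45).
move: z1 z2 z3 z4 dep {n12 n13 n14 n15 n23 n24 n25 n34 n35 n45}.
case: (rep o1) (rep o2) (rep o3) (rep o4) (rep o5) => [x1 y1] [x2 y2] [x3 y3] [x4 y4] [x5 y5].
rewrite /det2 /= => z1 z2 z3 z4 dep [[[[d24 d25] d34] d35] d45] [[[[d12 d13] d14] d15] d23].
(* The map is (X, Y): X vanishes at the second point, Y at the first, and the constants [m], [n]
   make both equal to 1 at the third. *)
pose m := (x3 * y2 - x2 * y3)^-1; pose n := (x3 * y1 - x1 * y3)^-1.
have d32 : x3 * y2 - x2 * y3 != 0 by rewrite -opprB oppr_eq0.
have d31 : x3 * y1 - x1 * y3 != 0 by rewrite -opprB oppr_eq0.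
have m0 : m != 0 by rewrite invr_eq0.
have n0 : n != 0 by rewrite invr_eq0.
pose X x y := m * y2 * x + (- (m * x2)) * y.
pose Y x y := n * y1 * x + (- (n * x1)) * y.
have XE x y : X x y = m * (x * y2 - x2 * y) by rewrite /X; ring.
have YE x y : Y x y = n * (x * y1 - x1 * y) by rewrite /Y; ring.
have depw v : v \in U1 F q ->
    c1 * dot v (pvec (X x1 y1, Y x1 y1)) + c2 * dot v (pvec (X x2 y2, Y x2 y2))
    + c3 * dot v (pvec (X x3 y3, Y x3 y3)) + c4 * dot v (pvec (X x4 y4, Y x4 y4))
    + c5 * dot v (pvec (X x5 y5, Y x5 y5)) = 0.
  move=> /(moebius_form (m * y2) (- (m * x2)) (n * y1) (- (n * x1)))[v' _ Ev].
  by rewrite -!Ev -!dotZ -!dotD dep dot0.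
have X3 : X x3 y3 = 1 by rewrite XE mulVf.
have Y3 : Y x3 y3 = 1 by rewrite YE mulVf.
have Y1 : Y x1 y1 = 0 by rewrite YE subrr mulr0.
have X2 : X x2 y2 = 0 by rewrite XE subrr mulr0.
have X1 : X x1 y1 != 0 by rewrite XE mulf_neq0.
have Y2 : Y x2 y2 != 0 by rewrite YE mulf_neq0 // -opprB oppr_eq0.
have X4 : X x4 y4 != 0 by rewrite XE mulf_neq0 // -opprB oppr_eq0.
have Y4 : Y x4 y4 != 0 by rewrite YE mulf_neq0 // -opprB oppr_eq0.
have X5 : X x5 y5 != 0 by rewrite XE mulf_neq0 // -opprB oppr_eq0.
have Y5 : Y x5 y5 != 0 by rewrite YE mulf_neq0 // -opprB oppr_eq0.
(* The map scales [det2] by its own determinant; this yields [t <> 1], [u <> 1] and [t <> u]. *)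
have XY x y x' y' : X x y * Y x' y' - X x' y' * Y x y =
    m * n * (x2 * y1 - x1 * y2) * (x * y' - x' * y) by rewrite /X /Y; ring.
have D0 : m * n * (x2 * y1 - x1 * y2) != 0 by rewrite !mulf_neq0 // -opprB oppr_eq0.
pose t := X x4 y4 / Y x4 y4; pose u := X x5 y5 / Y x5 y5.
have E4 : pvec (X x4 y4, Y x4 y4) = nm (Y x4 y4) *: pvec (t, 1).
  by rewrite -pvecZ mulr1 mulrC divfK.
have E5 : pvec (X x5 y5, Y x5 y5) = nm (Y x5 y5) *: pvec (u, 1).
  by rewrite -pvecZ mulr1 mulrC divfK.
have E1 : pvec (X x1 y1, Y x1 y1) = nm (X x1 y1) *: pvec (1, 0).
  by rewrite -pvecZ mulr1 mulr0 Y1.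
have E2 : pvec (X x2 y2, Y x2 y2) = nm (Y x2 y2) *: pvec (0, 1).
  by rewrite -pvecZ mulr1 mulr0 X2.
have t0 : t != 0 by rewrite mulf_neq0 ?invr_eq0.
have u0 : u != 0 by rewrite mulf_neq0 ?invr_eq0.
have ne1 x y : Y x y != 0 -> x * y3 - x3 * y != 0 -> X x y / Y x y != 1.
  move=> Yxy dxy; rewrite -subr_eq0 -(mulIr_eq0 _ (mulIf Yxy)) mulrBl divfK // mul1r.
  by have := XY x y x3 y3; rewrite X3 Y3 mulr1 mul1r => ->; rewrite mulf_neq0.
have t1 : t != 1 by rewrite ne1 // -opprB oppr_eq0.
have u1 : u != 1 by rewrite ne1 // -opprB oppr_eq0.
have tu : t != u.
  rewrite -subr_eq0 -(mulIr_eq0 _ (mulIf (mulf_neq0 Y4 Y5))).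
  have -> : (t - u) * (Y x4 y4 * Y x5 y5) =
            t * Y x4 y4 * Y x5 y5 - u * Y x5 y5 * Y x4 y4 by ring.
  by rewrite !divfK // XY mulf_neq0.
clearbody t u.
case: (@five_std_dep t u (c1 * nm (X x1 y1)) (c2 * nm (Y x2 y2)) c3
  (c4 * nm (Y x4 y4)) (c5 * nm (Y x5 y5)) K3 (FqM K4 (nm_Fq _)) (FqM K5 (nm_Fq _))
  t0 u0 u1 tu) => [v Uv|Kt|[]].
- by have := depw v Uv; rewrite E1 E2 E4 E5 X3 Y3 !dotZ !mulrA.
- right.
  (* Substituting the adjugate of the matrix of (X, Y) inverts the map up to the scalar
     determinant. *)
  have [w' Uw' Ew'] := moebius_form (- (n * x1)) (m * x2) (- (n * y1)) (m * y2) Uw.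
  have zw x y : dot w (pvec (x, y)) = 0 -> dot w' (pvec (X x y, Y x y)) = 0.
    move=> z; rewrite Ew'.
    have -> : (- (n * x1) * X x y + m * x2 * Y x y, - (n * y1) * X x y + m * y2 * Y x y)
      = (m * n * (x2 * y1 - x1 * y2) * x, m * n * (x2 * y1 - x1 * y2) * y).
      by congr pair; rewrite /X /Y; ring.
    by rewrite pvecZ dotZ z mulr0.
  have := zw _ _ z1; have := zw _ _ z2; have := zw _ _ z3; have := zw _ _ z4.
  rewrite E1 E2 E4 X3 Y3 !dotZ => {}z4 {}z3 {}z2 {}z1.
  apply: leq_trans (zeros_moebius_le _ Ew'); last first.
    suff -> : - (n * x1) * (m * y2) - m * x2 * (- (n * y1)) = m * n * (x2 * y1 - x1 * y2).
      by [].
    by ring.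
  (* Vanishing at infinity and 0 gives [D = A = 0]; vanishing at 1 and [t] gives Tr B + Tr C = 0 and
     t Tr B + t^2 Tr C = 0. As [t] is neither 0 nor 1, both traces are 0. *)
  have [A [B [C [D [KA KD Dw']]]]] := U1P _ Uw'.
  move/eqP: z1; rewrite mulf_eq0 nm_eq0 (negPf X1) /= Dw' dot_pvec /tr /nm !frobE => /eqP z1.
  have D_0 : D = 0 by rewrite -z1; ring.
  move/eqP: z2; rewrite mulf_eq0 nm_eq0 (negPf Y2) /= Dw' dot_pvec /tr /nm !frobE => /eqP z2.
  have A_0 : A = 0 by rewrite -z2; ring.
  have tBC : tr B + tr C = 0 by rewrite -z3 Dw' dot_pvec D_0 A_0 /tr /nm !frobE; ring.
  move/eqP: z4; rewrite mulf_eq0 nm_eq0 (negPf Y4) /= Dw' dot_pvec D_0 A_0 => /eqP z4.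
  have tBC' : t * tr B + t * t * tr C = 0.
    by rewrite -z4 /tr /nm !frobE !(Fq_frob Kt); ring.
  have C0 : tr C = 0.
    have : t * (t - 1) * tr C = 0.
      transitivity (t * tr B + t * t * tr C - t * (tr B + tr C)); first by ring.
      by rewrite tBC tBC' mulr0 subr0.
    by move/eqP; rewrite !mulf_eq0 subr_eq0 (negPf t0) (negPf t1) => /eqP.
  have B0 : tr B = 0 by rewrite -tBC C0 addr0.
  by rewrite card_zeros_subline.
move=> /eqP; rewrite mulf_eq0 nm_eq0 (negPf X1) orbF => /eqP->.
move=> /eqP; rewrite mulf_eq0 nm_eq0 (negPf Y2) orbF => /eqP-> ->.
move=> /eqP; rewrite mulf_eq0 nm_eq0 (negPf Y4) orbF => /eqP->.
move=> /eqP; rewrite mulf_eq0 nm_eq0 (negPf Y5) orbF => /eqP->.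
by left.
Qed.

(** * Subspaces over F_q, spans and hyperplanes *)

Lemma expn_ltq m n : (m < n)%N -> (q ^ m < q ^ n)%N.
Proof. by move=> mn; rewrite ltn_exp2l //; have := q_ge4; lia. Qed.

Lemma card_Fq_ffun n :
  #|(ffun_on (mem Fq) : {pred {ffun 'I_n -> F}})| = (q ^ n)%N.
Proof. by rewrite card_ffun_on card_ord cardFq. Qed.

(** An F_q-subspace as a bare set of vectors; its dimension enters only through its cardinality, a
    power of q. *)
Definition Fq_closed (A : {set vec F}) :=
  0 \in A /\ forall k u v, k \in Fq -> u \in A -> v \in A -> k *: u + v \in A.

Lemma Fq_closed_sum A (I : finType) (c : I -> F) (v : I -> vec F) :
  Fq_closed A -> (forall i, c i \in Fq) -> (forall i, c i != 0 -> v i \in A) ->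
  \sum_i c i *: v i \in A.
Proof.
move=> [A0 AD] Kc Av; apply: (big_ind (fun u => u \in A)) => // [u v' Au Av'|i _].
  by rewrite -[u]scale1r AD ?Fq1.
have [->|ci] := eqVneq (c i) 0; first by rewrite scale0r.
by rewrite -[_ *: _]addr0 AD ?Av.
Qed.

Lemma KspanP (l : seq (vec F)) u : reflect
  (exists2 c : 'I_(size l) -> F, (forall i, c i \in Fq) & u = \sum_i c i *: l`_i)
  (u \in Kspan q l).
Proof.
rewrite inE; apply: (iffP existsP) => [[c /andP[/forallP Kc /eqP->]]|[c Kc ->]].
  by exists c => // i; rewrite inE.
exists (finfun c); apply/andP; split; first by apply/forallP => i; rewrite ffunE -in_set -/Fq.
by apply/eqP/eq_bigr => i _; rewrite ffunE.
Qed.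

Lemma Kspan_closed (l : seq (vec F)) : Fq_closed (Kspan q l).
Proof.
split=> [|k u v Kk /KspanP[c Kc ->] /KspanP[c' Kc' ->]]; apply/KspanP.
  by exists (fun=> 0) => [i|]; rewrite ?Fq0 // big1 // => i _; rewrite scale0r.
exists (fun i => k * c i + c' i) => [i|]; first by rewrite FqD ?FqM.
by rewrite scaler_sumr -big_split; apply: eq_bigr => i _; rewrite /= scalerDl scalerA.
Qed.

Lemma Kspan_nth (l : seq (vec F)) i : (i < size l)%N -> l`_i \in Kspan q l.
Proof.
move=> ltil; apply/KspanP; exists (fun j => (j == Ordinal ltil)%:R) => [j|].
  by case: eqP; rewrite ?Fq0 ?Fq1.
rewrite (bigD1 (Ordinal ltil)) //= eqxx scale1r big1 ?addr0 // => j /negPf->.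
by rewrite scale0r.
Qed.

Lemma Kspan_mem (l : seq (vec F)) u : u \in l -> u \in Kspan q l.
Proof. by move/(nthP 0) => [i lti <-]; apply: Kspan_nth. Qed.

Lemma Kspan_sub (l : seq (vec F)) A :
  Fq_closed A -> (forall u, u \in l -> u \in A) -> Kspan q l \subset A.
Proof.
move=> clA lA; apply/subsetP => _ /KspanP[c Kc ->].
by apply: Fq_closed_sum => // i _; apply/lA/mem_nth.
Qed.

Lemma card_Kspan_le (l : seq (vec F)) : (#|Kspan q l| <= q ^ size l)%N.
Proof.
rewrite -card_Fq_ffun.
apply: leq_trans (leq_imset_card
  (fun c : {ffun 'I_(size l) -> F} => \sum_i c i *: l`_i) _).
apply/subset_leq_card/subsetP => _ /KspanP[c Kc ->]; apply/imsetP.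
exists (finfun c); first by apply/ffun_onP => i; rewrite ffunE; apply: Kc.
by apply: eq_bigr => i _; rewrite ffunE.
Qed.

Lemma card_Kspan_free (l : seq (vec F)) : Kfree q l -> #|Kspan q l| = (q ^ size l)%N.
Proof.
move=> fr; apply/eqP; rewrite eqn_leq card_Kspan_le /=.
rewrite -card_Fq_ffun.
rewrite -(card_in_imset (f := fun c : {ffun 'I_(size l) -> F} => \sum_i c i *: l`_i)).
  apply/subset_leq_card/subsetP => _ /imsetP[c /ffun_onP Kc ->].
  by apply/KspanP; exists c.
move=> c c' /ffun_onP Kc /ffun_onP Kc' E; apply/ffunP => i; apply/eqP.
rewrite -subr_eq0; apply/eqP; apply: (fr (fun i => c i - c' i)) => [j|].
  by have := FqB (Kc j) (Kc' j); rewrite inE.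
rewrite (eq_bigr (fun i => c i *: l`_i - c' i *: l`_i)) => [|j _]; last exact: scalerBl.
by rewrite sumrB E subrr.
Qed.

Lemma card_U1 : #|U1 F q| = (q ^ 8)%N.
Proof.
pose f (z : F * (F * (F * F))) := vecU q z.1 z.2.1 z.2.2.1 z.2.2.2.
pose D := setX Fq (setX [set: F] (setX [set: F] Fq)).
have -> : U1 F q = f @: D.
  apply/setP => u; apply/U1P/imsetP => [[a [b [c [d [Ka Kd ->]]]]]|].
    by exists (a, (b, (c, d))); rewrite // !in_setX !in_setT Ka.
  move=> [[a [b [c d]]]]; rewrite !in_setX !in_setT /= => /andP[Ka Kd] ->.
  by exists a, b, c, d.
rewrite card_imset; last by move=> [a [b [c d]]] [a' [b' [c' d']]] /vecU_inj /= [-> -> -> ->].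
by rewrite !cardsX !cardsT cardFq cardF -!expnSr -!expnD.
Qed.

Lemma U1_closed : Fq_closed (U1 F q).
Proof. by split=> [|k u v Kk Uu Uv]; rewrite ?U1_0 // U1_D ?U1_Z. Qed.

(** Pigeonhole: U_1 has [q^8] vectors but there are at most [q^7] tuples of values on [vs], and the
    difference of two vectors with equal tuples is orthogonal to [vs]. *)
Lemma perp_exists (vs : seq (vec F)) : (size vs <= 7)%N -> {subset vs <= U1 F q} ->
  exists2 w, w \in U1 F q & w != 0 /\ {in vs, forall u, dot w u = 0}.
Proof.
move=> sz Uvs; pose f w := [ffun i : 'I_(size vs) => dot w vs`_i].
have : ~~ dinjectiveb f (mem (U1 F q)).
  apply/negP => /dinjectiveP inj.
  have := card_in_imset inj; rewrite card_U1 => cU.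
  have : (#|f @: U1 F q| <= q ^ size vs)%N.
    rewrite -card_Fq_ffun.
    apply/subset_leq_card/subsetP => _ /imsetP[w Uw ->]; apply/ffun_onP => i.
    by rewrite ffunE dot_Fq // Uvs ?mem_nth.
  by rewrite leqNgt cU expn_ltq.
case/dinjectivePn => w Uw [w' /andP[/= nw' Uw'] E]; exists (w' - w).
  by rewrite -scaleN1r U1_D ?U1_Z ?FqN ?Fq1.
split=> [|u /(nthP 0)[i lti <-]]; first by rewrite subr_eq0.
have := congr1 (fun g : {ffun 'I_(size vs) -> F} => g (Ordinal lti)) E.
by rewrite !ffunE /= -scaleN1r dotDl dotZl => ->; rewrite mulN1r subrr.
Qed.

(** The projective line has [q^3 + 1] points, more than the bound of [card_zeros]. *)
Lemma nonzero_form w : w \in U1 F q -> w != 0 -> exists o, dot w (pvec (rep o)) != 0.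
Proof.
move=> Uw w0; apply/existsP; apply: contraLR (card_zeros Uw w0) => /existsPn E.
rewrite (_ : zeros w = setT); last by apply/setP => o; rewrite !inE; apply/negPn/E.
rewrite cardsT card_option cardF (expnS q 2); have := q_sqr; have := q_ge4.
by move=> q4 q2; rewrite -ltnNge; nia.
Qed.

Lemma hyperplane_form (H : {set vec F}) : hyperplane q H ->
  exists2 w, w \in U1 F q & w != 0 /\ H = [set u in U1 F q | dot w u == 0].
Proof.
move=> [[l [szl frl DH]] HU].
have lU : {subset l <= U1 F q}.
  by move=> u ul; apply: (subsetP HU); rewrite DH Kspan_mem.
have [|w Uw [w0 wl]] := perp_exists _ lU; first by rewrite szl.
exists w => //; split=> //; apply/eqP; rewrite eqEcard; apply/andP; split.
  rewrite DH; apply: Kspan_sub => [|u ul]; last by rewrite inE lU ?wl ?eqxx.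
  split=> [|k u v Kk /setIdP[Uu /eqP zu] /setIdP[Uv /eqP zv]].
    by rewrite inE U1_0 dot0 eqxx.
  by apply/setIdP; rewrite U1_D ?U1_Z // dotD dotZ zu zv mulr0 addr0 eqxx.
rewrite DH card_Kspan_free // szl -(@leq_pmul2r q); last by have := q_ge4; lia.
have [o ow] := nonzero_form Uw w0; set u0 := pvec (rep o) in ow.
rewrite -expnSr -card_U1 -[X in (_ * X)%N]cardFq -cardsX.
rewrite -(card_in_imset (f := fun z : vec F * F => z.1 + z.2 *: u0)).
  apply/subset_leq_card/subsetP => _ /imsetP[[u k] /setXP[/setIdP[Uu _] Kk] ->].
  by rewrite /= U1_D ?U1_Z ?pvec_U1.
move=> [u k] [u' k'] /setXP[/setIdP[_ /eqP zu] _] /setXP[/setIdP[_ /eqP zu'] _] /= E.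
have := congr1 (dot w) E; rewrite !dotD !dotZ zu zu' !add0r => /(mulIf ow) Ek.
by move: E; rewrite Ek => /addIr ->.
Qed.

(** * Linear relations over F_q as words of a code *)

Section Words.

Variables (I : finType) (v : I -> vec F).
Implicit Types e : {ffun I -> F}.

Definition combo (e : {ffun I -> F}) : vec F := \sum_i e i *: v i.
Definition wsupp (e : {ffun I -> F}) : {set I} := [set i | e i != 0].

(** The code whose parity-check columns are the vectors [v i], shortened to the positions in [D]:
    its words are the F_q-relations supported in [D]. *)
Definition is_word (D : {set I}) (e : {ffun I -> F}) : bool :=
  (e \in pffun_on 0 (mem D) (mem Fq)) && (combo e == 0).

Lemma pffun_FqP (D : {set I}) e : reflect
  ((forall i, e i \in Fq) /\ wsupp e \subset D) (e \in pffun_on 0 (mem D) (mem Fq)).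
Proof.
apply: (iffP pffun_onP) => -[]; last first.
  move=> Kc /subsetP sD; split; last by move=> _ /imageP[i _ ->]; apply: Kc.
  by apply/subsetP => i ci; apply: sD; rewrite inE.
move=> /subsetP sD im; split; last by apply/subsetP => i; rewrite inE => /sD.
move=> i; have [->|ci] := eqVneq (e i) 0; first exact: Fq0.
by apply: im; apply: image_f; apply: sD.
Qed.

Definition lin2 k (e : {ffun I -> F}) k' (e' : {ffun I -> F}) : {ffun I -> F} :=
  [ffun i => k * e i + k' * e' i].

Lemma combo_lin2 k e k' e' : combo (lin2 k e k' e') = k *: combo e + k' *: combo e'.
Proof.
rewrite /combo !scaler_sumr -big_split; apply: eq_bigr => i _ /=.
by rewrite ffunE scalerDl !scalerA.
Qed.

Lemma pffun_lin2 (D : {set I}) k e k' e' : k \in Fq -> k' \in Fq ->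
  e \in pffun_on 0 (mem D) (mem Fq) -> e' \in pffun_on 0 (mem D) (mem Fq) ->
  lin2 k e k' e' \in pffun_on 0 (mem D) (mem Fq).
Proof.
move=> Kk Kk' /pffun_FqP[Kc sc] /pffun_FqP[Kc' sc']; apply/pffun_FqP; split=> [i|].
  by rewrite ffunE FqD ?FqM.
apply/subsetP => i; rewrite inE ffunE; apply: contraR => iD.
have -> : e i = 0 by apply/eqP; apply: contraR iD => ci; rewrite (subsetP sc) ?inE.
have -> : e' i = 0 by apply/eqP; apply: contraR iD => ci; rewrite (subsetP sc') ?inE.
by rewrite !mulr0 addr0.
Qed.

Lemma is_word_lin2 (D : {set I}) k e k' e' : k \in Fq -> k' \in Fq ->
  is_word D e -> is_word D e' -> is_word D (lin2 k e k' e').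
Proof.
move=> Kk Kk' /andP[Dc /eqP Ec] /andP[Dc' /eqP Ec'].
by rewrite /is_word pffun_lin2 // combo_lin2 Ec Ec' !scaler0 addr0 eqxx.
Qed.

Lemma wsupp_eq0 e : (wsupp e == set0) = (e == 0).
Proof.
apply/eqP/eqP => [E|->]; last by apply/setP => i; rewrite !inE ffunE eqxx.
apply/ffunP => i; rewrite ffunE; apply/eqP/negPn.
by have /setP/(_ i) := E; rewrite !inE => ->.
Qed.

Lemma word_of_collision (T : {set {ffun I -> F}}) (A : {set vec F}) :
  {in T, forall e, combo e \in A} -> (#|A| < #|T|)%N ->
  exists e e', [/\ e \in T, e' \in T, e != e' & combo e = combo e'].
Proof.
move=> TA ltAT; have : ~~ dinjectiveb combo (mem T).
  apply/negP => /dinjectiveP inj; move: ltAT; rewrite ltnNge => /negP; apply.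
  rewrite -(card_in_imset inj); apply/subset_leq_card/subsetP => _ /imsetP[e Tc ->].
  exact: TA.
case/dinjectivePn => e Tc [e' /andP[/= n Tc'] E].
by exists e, e'; rewrite eq_sym.
Qed.

Lemma combo_closed (D : {set I}) A e : Fq_closed A -> {in D, forall i, v i \in A} ->
  e \in pffun_on 0 (mem D) (mem Fq) -> combo e \in A.
Proof.
move=> clA DA /pffun_FqP[Kc /subsetP sc]; apply: Fq_closed_sum => // i ci.
by apply/DA/sc; rewrite inE.
Qed.

Lemma lin2_1N1_neq0 e e' : e != e' -> lin2 1 e (-1) e' != 0.
Proof.
apply: contraNneq => /ffunP E; apply/eqP/ffunP => i; apply/eqP.
by have := E i; rewrite !ffunE mul1r mulN1r => /eqP; rewrite subr_eq0.
Qed.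

(** Two of the [q^|D|] combinations coincide, and their difference is a relation. *)
Lemma word_exists (D : {set I}) A : Fq_closed A -> {in D, forall i, v i \in A} ->
  (#|A| < q ^ #|D|)%N -> exists2 e, is_word D e & e != 0.
Proof.
move=> clA DA ltA; pose T := [set e | e \in pffun_on 0 (mem D) (mem Fq)].
have [||e [e' [Tc Tc' n E]]] := @word_of_collision T A.
- by move=> e; rewrite inE; apply: combo_closed.
- by rewrite cardsE card_pffun_on cardFq.
exists (lin2 1 e (-1) e'); last exact: lin2_1N1_neq0.
move: Tc Tc'; rewrite !inE => Tc Tc'.
by rewrite /is_word pffun_lin2 ?FqN ?Fq1 // combo_lin2 E scale1r scaleN1r subrr eqxx.
Qed.

Lemma wsupp_lin2 k e k' e' : wsupp (lin2 k e k' e') \subset wsupp e :|: wsupp e'.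
Proof.
apply/subsetP => i; rewrite !inE ffunE; apply: contraR; rewrite negb_or !negbK.
by move=> /andP[/eqP-> /eqP->]; rewrite !mulr0 addr0.
Qed.

Lemma card_wsupp3 (Z : {set I}) :
  ('C(#|Z|, 3) * q.-1 ^ 3 <=
     #|[set e : {ffun I -> F} |
         (e \in pffun_on 0%R (mem Z) (mem Fq)) && (#|wsupp e| == 3%N)]|)%N.
Proof.
rewrite -cards_draws -sum_nat_const -[X in (_ <= X)%N]sum1_card.
rewrite (partition_big wsupp (mem [set D : {set I} | D \subset Z & #|D| == 3%N])) /=.
  apply: leq_sum => D; rewrite inE => /andP[DZ D3].
  have <- : #|pffun_on 0 (mem D) (mem (Fq :\ 0))| = (q.-1 ^ 3)%N.
    rewrite card_pffun_on (eqP D3); congr (_ ^ 3)%N.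
    by have := cardsD1 0 Fq; rewrite Fq0 cardFq => ->.
  rewrite sum1_card; apply/subset_leq_card/subsetP => e /pffun_onP[/subsetP sc im].
  have Dc : wsupp e = D.
    apply/setP => i; rewrite inE; apply/idP/idP => [/sc //|iD].
    by have := im (e i) (image_f _ iD); rewrite !inE => /andP[].
  rewrite unfold_in /= inE Dc eqxx D3 !andbT; apply/pffun_FqP; split; last by rewrite Dc.
  move=> i; have [->|ci] := eqVneq (e i) 0; first exact: Fq0.
  have iD : i \in D by rewrite -Dc inE.
  by have := im (e i) (image_f _ iD); rewrite !inE => /andP[].
by move=> e; rewrite !inE => /andP[/pffun_FqP[_ ->] ->].
Qed.

(** Two distinct weight-3 vectors must have the same syndrome [combo]; their difference is a word of
    weight at most 6. *)
Lemma sphere_packing_word (Z : {set I}) A :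
  Fq_closed A -> {in Z, forall i, v i \in A} ->
  (#|A| < 'C(#|Z|, 3) * q.-1 ^ 3)%N ->
  exists2 e, is_word Z e & e != 0 /\ (#|wsupp e| <= 6)%N.
Proof.
move=> clA ZA ltA.
have [|//|e [e' [Tc Tc' n E]]] := @word_of_collision
    [set e | (e \in pffun_on 0 (mem Z) (mem Fq)) && (#|wsupp e| == 3%N)] A.
- by move=> e; rewrite inE => /andP[cP _]; apply: combo_closed cP.
- exact: leq_trans ltA (card_wsupp3 Z).
move: Tc Tc'; rewrite !inE => /andP[Tc /eqP c3] /andP[Tc' /eqP c3'].
exists (lin2 1 e (-1) e').
  by rewrite /is_word pffun_lin2 ?FqN ?Fq1 // combo_lin2 E scale1r scaleN1r subrr eqxx.
split; first exact: lin2_1N1_neq0.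
apply: leq_trans (subset_leq_card (wsupp_lin2 _ _ _ _)) _.
by apply: leq_trans (leq_card_setU _ _) _; rewrite c3 c3'.
Qed.

(* Ten vectors, any six independent, in a 7-dimensional space over F_4 would have
   a [10,3,7] code of linear relations, i.e. they would give 10 points of PG(2,4)
   with at most 3 on a line. Counting the lines through a point, each of the 10
   points would be on exactly four 3-secants, but 3 does not divide 40. *)
Section Arc.

Variables (D : {set I}) (A : {set vec F}).
Hypotheses (q4 : q = 4%N) (clA : Fq_closed A) (cardA : #|A| = (q ^ 7)%N).
Hypotheses (DA : {in D, forall i, v i \in A}) (cardD : #|D| = 10%N).
Hypothesis min7 : forall e, is_word D e -> e != 0 -> (7 <= #|wsupp e|)%N.

(** In the plane picture the elements of [D] are points, nonzero words up to scalars are lines, and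
    [zs e] is the set of points on the line [e]. *)
Let zs (e : {ffun I -> F}) : {set I} := D :\: wsupp e.

Let in_zs e i : (i \in zs e) = (i \in D) && (e i == 0).
Proof. by rewrite !inE negbK andbC. Qed.

Let card_zs e : is_word D e -> e != 0 -> (#|zs e| <= 3)%N.
Proof.
move=> De e0; have := min7 De e0; have /andP[/pffun_FqP[_ sD] _] := De.
by have := cardsID (wsupp e) D; rewrite (setIidPr sD) cardD /zs; lia.
Qed.

Definition indep2 (e1 e2 : {ffun I -> F}) := forall k k',
  k \in Fq -> k' \in Fq -> lin2 k e1 k' e2 = 0 -> k = 0 /\ k' = 0.

(** The pencil of lines spanned by [e1] and [e2] is indexed by the projective line over F_q, and
    this is the index of the member through the point i. Points on both lines also receive [None];
    they are removed from the fibres below. *)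
Definition pencil_ix (e1 e2 : {ffun I -> F}) i : option F :=
  if e2 i == 0 then None else Some (e1 i / e2 i).
Definition pencil (e1 e2 : {ffun I -> F}) (g : option F) : {ffun I -> F} :=
  if g is Some k then lin2 1 e1 (- k) e2 else e2.
Definition P1 : {set option F} := None |: Some @: Fq.

Let card_P1 : #|P1| = 5%N.
Proof.
rewrite cardsU1 card_imset; last by move=> x y [].
rewrite cardFq q4; suff -> : None \notin Some @: Fq by [].
by apply/imsetP => -[].
Qed.

Section Pencil.
Variables (e1 e2 : {ffun I -> F}).
Hypotheses (De1 : is_word D e1) (De2 : is_word D e2) (ind : indep2 e1 e2).

Let cz := zs e1 :&: zs e2.
Let fib g := [set i in D :\: cz | pencil_ix e1 e2 i == g].

Let word_pencil g : g \in P1 -> is_word D (pencil e1 e2 g).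
Proof.
rewrite in_setU1 => /orP[/eqP->//|/imsetP[k Kk ->]] /=.
by rewrite is_word_lin2 ?Fq1 ?FqN.
Qed.

Let pencil_neq0 g : g \in P1 -> pencil e1 e2 g != 0.
Proof.
rewrite in_setU1 => /orP[/eqP->|/imsetP[k Kk ->]] /=; apply/eqP => E.
  have [_ /eqP] : (0 : F) = 0 /\ (1 : F) = 0; last by rewrite oner_eq0.
  apply: ind; rewrite ?Fq0 ?Fq1 //; apply/ffunP => i.
  by rewrite E !ffunE mul0r mulr0 addr0.
have [/eqP + _] : (1 : F) = 0 /\ - k = 0 by apply: ind E; rewrite ?Fq1 ?FqN.
by rewrite oner_eq0.
Qed.

Let zs_pencil g : g \in P1 -> zs (pencil e1 e2 g) = cz :|: fib g.
Proof.
move=> aP; apply/setP => i; rewrite in_setU in_setI !in_zs in_set in_setD in_setI !in_zs.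
have [iD|] := boolP (i \in D); rewrite ?andbF //= andbT /pencil_ix.
move: aP; rewrite in_setU1 => /orP[/eqP->|/imsetP[k Kk ->]] /=.
  by case: (e2 i == 0); case: (e1 i == 0).
rewrite ffunE mul1r mulNr subr_eq0.
have [e20|e20] := eqVneq (e2 i) 0; rewrite ?e20 ?mulr0 /=.
  by case: (e1 i == 0).
by rewrite andbF /= -(can2_eq (divfK e20) (mulfK e20)).
Qed.

Let card_fib g : g \in P1 ->
  (#|fib g| + #|cz| <= 3)%N /\ (#|zs (pencil e1 e2 g)| = #|fib g| + #|cz|)%N.
Proof.
move=> gP; have := card_zs (word_pencil gP) (pencil_neq0 gP).
have dis : cz :&: fib g = set0.
  apply/setP => i; rewrite in_set0; apply/negP.
  by move=> /setIP[icz /setIdP[/setDP[_ /negP]]].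
by rewrite zs_pencil // cardsU dis cards0 subn0 addnC.
Qed.

Let ix_P1 i : pencil_ix e1 e2 i \in P1.
Proof.
have /andP[/pffun_FqP[K1 _] _] := De1; have /andP[/pffun_FqP[K2 _] _] := De2.
rewrite /pencil_ix; case: (e2 i == 0); rewrite in_setU1 //=.
by apply/imsetP; exists (e1 i / e2 i); first exact: FqM (K1 i) (FqV (K2 i)).
Qed.

Let sum_fib : (\sum_(g in P1) #|fib g| = #|D :\: cz|)%N.
Proof.
rewrite -[RHS]sum1_card (partition_big (pencil_ix e1 e2) (mem P1)) => [|i _];
  last exact: ix_P1.
by apply: eq_bigr => g _; rewrite -sum1_card; apply: eq_bigl => i; rewrite !inE.
Qed.

(** With z common zeros, the other [10 - z] points are distributed over five members with at most
    [3 - z] each, so [10 - z <= 5 (3 - z)] and [z <= 1]. *)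
Lemma indep_common_zero : (#|zs e1 :&: zs e2| <= 1)%N.
Proof.
have cD : (#|D :\: cz| + #|cz| = 10)%N.
  rewrite -cardD -(cardsID cz D) addnC; congr addn; apply/eq_card => i.
  by rewrite !inE; case: (i \in D); rewrite ?andbF.
have le : (\sum_(g in P1) #|fib g| <= \sum_(g in P1) (3 - #|cz|))%N.
  by apply: leq_sum => g /card_fib[+ _]; rewrite -/cz; lia.
rewrite sum_nat_const card_P1 sum_fib in le.
(* This supplies [|cz| <= 3], which keeps the subtraction from being truncated. *)
have [+ _] := card_fib (setU11 None _); rewrite -/cz; lia.
Qed.

(** The nine points other than i lie on five lines through i, with at most two on each. Three full
    lines would hold at most eight of them, and five full lines would hold ten. *)
Lemma card_pencil_triples i : i \in zs e1 -> i \in zs e2 ->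
  #|(fun g => zs (pencil e1 e2 g)) @: [set g in P1 | #|zs (pencil e1 e2 g)| == 3%N]| = 4%N.
Proof.
move=> z1 z2; have i_cz : i \in cz by rewrite inE z1.
have cz1 : #|cz| = 1%N.
  by apply/eqP; rewrite eqn_leq indep_common_zero card_gt0; apply/set0Pn; exists i.
have cD : #|D :\: cz| = 9%N.
  have : (#|D :\: cz| + #|cz| = 10)%N; last by lia.
  rewrite -cardD -(cardsID cz D) addnC; congr addn; apply/eq_card => j.
  by rewrite !inE; case: (j \in D); rewrite ?andbF.
set B := [set g in P1 | _].
(* A member with three zeros has one outside [cz], whose index recovers the member. *)
rewrite card_in_imset => [|g b]; last first.
  move=> /setIdP[aP /eqP a3] /setIdP[bP /eqP b3] /= E.
  have : (0 < #|fib g|)%N by have [_] := card_fib aP; rewrite a3 cz1; lia.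
  rewrite card_gt0 => /set0Pn[j ja]; have := ja; rewrite inE => /andP[+ /eqP ja'].
  rewrite in_setD => /andP[jcz _].
  have : j \in zs (pencil e1 e2 g) by rewrite zs_pencil // inE ja orbT.
  by rewrite E zs_pencil // in_setU (negPf jcz) inE => /andP[_ /eqP <-].
have BP : B \subset P1 by apply/subsetP => g /setIdP[].
have le : (\sum_(g in P1) #|fib g| <= \sum_(g in P1) (1 + (g \in B)))%N.
  apply: leq_sum => g aP; have [h1 h2] := card_fib aP.
  by rewrite inE aP h2 cz1 /=; case: eqP; rewrite cz1 in h1; lia.
rewrite sum_fib cD big_split /= sum1_card card_P1 in le.
rewrite (big_mkcond (mem P1)) /= in le.
have sB : (\sum_i (if i \in P1 then nat_of_bool (i \in B) else 0) = #|B|)%N.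
  rewrite -sum1_card [RHS]big_mkcond; apply: eq_bigr => g _.
  have [gP|gP] := boolP (g \in P1); first by case: (g \in B).
  by rewrite [g \in B](_ : _ = false) //; apply: contraNF gP => /(subsetP BP).
rewrite sB in le.
have := subset_leq_card BP; rewrite card_P1.
suff : #|B| != 5%N by move: le; case: #|B| => [|[|[|[|[|[|m]]]]]].
apply/eqP => B5; have /eqP EB : B == P1 by rewrite eqEcard BP card_P1 B5.
have : (\sum_(g in P1) #|fib g| = \sum_(g in P1) 2)%N.
  apply: eq_bigr => g aP; have [_] := card_fib aP.
  by move: aP; rewrite -EB inE => /andP[_ /eqP->]; rewrite cz1; lia.
by rewrite sum_fib cD sum_nat_const card_P1.
Qed.

Lemma pencil_through i : i \in D -> exists2 g, g \in P1 & i \in zs (pencil e1 e2 g).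
Proof.
move=> iD; exists (pencil_ix e1 e2 i) => //.
rewrite zs_pencil // in_setU orbC inE in_setD iD eqxx !andbT.
by case: (i \in cz).
Qed.

Lemma pencil_wordP g : g \in P1 -> is_word D (pencil e1 e2 g) /\ pencil e1 e2 g != 0.
Proof. by move=> aP; rewrite word_pencil ?pencil_neq0. Qed.

End Pencil.

(** Two points determine a line: if [e'] were nonzero at a zero of [e], the two words would be
    independent with two common zeros. *)
Lemma zs_sub_of_two_zeros e e' i j : is_word D e -> is_word D e' -> e != 0 ->
  i != j -> i \in zs e -> j \in zs e -> i \in zs e' -> j \in zs e' -> zs e \subset zs e'.
Proof.
move=> De De' e0 ij ie je ie' je'; apply/subsetP => l; rewrite !in_zs => /andP[lD /eqP el].
rewrite lD /=; apply/negPn/negP => el'.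
have ind : indep2 e e'.
  move=> k k' Kk Kk' /ffunP E.
  have k'0 : k' = 0.
    apply/eqP; have := E l; rewrite !ffunE el mulr0 add0r => /eqP.
    by rewrite mulf_eq0 (negPf el') orbF.
  split=> //; apply/eqP/negPn/negP => k0; case/negP: e0; apply/eqP/ffunP => m.
  have := E m; rewrite !ffunE k'0 mul0r addr0 => /eqP.
  by rewrite mulf_eq0 (negPf k0) => /eqP.
have := indep_common_zero De De' ind; rewrite leqNgt => /negP; apply.
have <- : #|[set i; j]| = 2%N by rewrite cards2 ij.
by apply/subset_leq_card/subsetP => m /set2P[] ->; apply/setIP.
Qed.

(** The other eight vectors lie in a 7-dimensional space, so they are dependent. *)
Lemma word_vanishing2 i j : i \in D -> j \in D -> i != j ->
  exists2 e, is_word D e & [/\ e != 0, e i = 0 & e j = 0].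
Proof.
move=> iD jD ij; pose D' := D :\ i :\ j.
have cD' : #|D'| = 8%N.
  have := cardsD1 i D; have := cardsD1 j (D :\ i).
  by rewrite iD !inE jD eq_sym ij /= cardD /D'; lia.
have [||e /andP[/pffun_FqP[Ke /subsetP sD'] Ee] e0] := @word_exists D' A clA.
- by move=> l; rewrite !inE => /and3P[_ _ /DA].
- by rewrite cardA cD' expn_ltq.
have vanish l : l \notin D' -> e l = 0.
  by move=> lD; apply/eqP; apply: contraR lD => el; rewrite sD' // inE.
exists e; last by rewrite e0 !vanish // !inE ?eqxx ?andbF.
apply/andP; split=> //; apply/pffun_FqP; split=> //; apply/subsetP => l /sD'.
by rewrite !inE => /and3P[].
Qed.

Lemma no_ten_arc : False.
Proof.
pose Ts := [set T : {set I} | (#|T| == 3%N) &&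
  [exists e : {ffun I -> F}, [&& is_word D e, e != 0 & zs e == T]]].
have through i : i \in D -> #|[set T in Ts | i \in T]| = 4%N.
  move=> iD.
  (* Two distinct lines through i are needed: [e1] also passes through j, and [e2] through a point l
     off [e1]. *)
  have [|j jD ij] := exists_other_mem iD; first by rewrite cardD.
  have [e1 De1 [e10 e1i _]] := word_vanishing2 iD jD ij.
  have [l e1l] : exists l, l \in wsupp e1 by apply/set0Pn; rewrite wsupp_eq0.
  have lD : l \in D by have /andP[/pffun_FqP[_ /subsetP->]] := De1.
  rewrite inE in e1l.
  have il : i != l by apply: contraNneq e1l => <-; rewrite e1i.
  have [e2 De2 [e20 e2i e2l]] := word_vanishing2 iD lD il.
  have ind : indep2 e1 e2.
    move=> k k' Kk Kk' /ffunP E.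
    have k0 : k = 0.
      apply/eqP; have := E l; rewrite !ffunE e2l mulr0 addr0 => /eqP.
      by rewrite mulf_eq0 (negPf e1l) orbF.
    split=> //; apply/eqP/negPn/negP => k0'; case/negP: e20; apply/eqP/ffunP => m.
    have := E m; rewrite !ffunE k0 mul0r add0r => /eqP.
    by rewrite mulf_eq0 (negPf k0') => /eqP.
  have z1 : i \in zs e1 by rewrite in_zs iD e1i eqxx.
  have z2 : i \in zs e2 by rewrite in_zs iD e2i eqxx.
  have zp g : i \in zs (pencil e1 e2 g).
    rewrite in_zs iD; case: g => [k|] /=; last by rewrite e2i.
    by rewrite ffunE e1i e2i !mulr0 addr0.
  rewrite -(card_pencil_triples De1 De2 ind z1 z2); apply: eq_card => T.
  apply/setIdP/imsetP => [[]|[g /setIdP[aP a3] ->]]; last first.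
    have [Wa Wa0] := pencil_wordP De1 De2 ind aP.
    split; last exact: zp.
    by rewrite inE a3; apply/existsP; exists (pencil e1 e2 g); rewrite Wa Wa0 eqxx.
  (* A triple through i contains a second point m; the pencil member through m shares i and m with
     it, hence has the same zeros. *)
  rewrite inE => /andP[T3 /existsP[e /and3P[De e0 /eqP eT]]] iT.
  have [|m mT im] := exists_other_mem iT; first by rewrite (eqP T3).
  have mD : m \in D by move: mT; rewrite -eT in_zs => /andP[].
  have [g aP ma] := pencil_through De1 De2 mD.
  have [Wa Wa0] := pencil_wordP De1 De2 ind aP.
  have E : T = zs (pencil e1 e2 g).
    by apply/eqP; rewrite eqEsubset -eT; apply/andP; split;
      apply: (zs_sub_of_two_zeros _ _ _ im); rewrite ?eT.
  by exists g => //; apply/setIdP; rewrite -E.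
have : (\sum_(T in Ts) #|T| = 40)%N.
  transitivity (\sum_(i in D) \sum_(T in Ts | i \in T) 1)%N.
    rewrite (exchange_big_dep (mem Ts)) //=; last by move=> i T _ /andP[].
    apply: eq_bigr => T TT; rewrite -sum1_card; apply: eq_bigl => i.
    rewrite TT; move: TT; rewrite inE => /andP[_ /existsP[e /and3P[_ _ /eqP <-]]].
    by rewrite in_zs; case: (i \in D).
  rewrite (eq_bigr (fun=> 4%N)) => [|i iD]; first by rewrite sum_nat_const cardD.
  by rewrite -(through i iD) -sum1_card; apply: eq_bigl => T; rewrite [RHS]inE.
rewrite (eq_bigr (fun=> 3%N)) => [|T]; last by rewrite inE => /andP[/eqP->].
by rewrite sum_nat_const; lia.
Qed.

End Arc.

End Words.

(** * The hyperplane section with [q^2 - q + 1] points *)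

Section Main.

Variables (H1 : {set vec F}) (w : vec F).
Hypotheses (Uw : w \in U1 F q) (w0 : w != 0).
Hypothesis DH1 : H1 = [set u in U1 F q | dot w u == 0].
Hypothesis cardH1 : #|H1| = (q ^ 7)%N.
Hypothesis cardZ : #|zeros w| = (q ^ 2 - q + 1)%N.

Let pv o := pvec (rep o).
Let pt o := Kspan q [:: pv o].

Lemma H1_closed : Fq_closed H1.
Proof.
rewrite DH1; split=> [|k u v Kk /setIdP[Uu /eqP zu] /setIdP[Uv /eqP zv]].
  by rewrite inE U1_0 dot0 eqxx.
by apply/setIdP; rewrite U1_D ?U1_Z // dotD dotZ zu zv mulr0 addr0 eqxx.
Qed.

Lemma pv_H1 o : (pv o \in H1) = (o \in zeros w).
Proof. by rewrite DH1 [RHS]inE; apply/setIdP/idP => [[]|] //; rewrite pvec_U1. Qed.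

(** A nontrivial relation would give [w] at least [q^2 + 1] zeros by [card_zeros_five_dep], but it
    has only [q^2 - q + 1]. *)
Lemma zeros_indep5 (D : {set option F}) e :
  D \subset zeros w -> #|D| = 5%N -> is_word pv D e -> e = 0.
Proof.
move=> DZ D5 /andP[/pffun_FqP[Ke /subsetP sD] /eqP Ee].
have : combo pv e = \sum_(o <- enum D) e o *: pv o.
  rewrite big_enum /= /combo [LHS](bigID (mem D)) /= [X in _ + X]big1 ?addr0 // => o oD.
  by rewrite (_ : e o = 0) ?scale0r //; apply/eqP; apply: contraR oD => eo; rewrite sD // inE.
have := enum_uniq D; have eD o : (o \in enum D) = (o \in D) by rewrite mem_enum.
have : size (enum D) = 5%N by rewrite -cardE.
case: (enum D) eD => [|o1 [|o2 [|o3 [|o4 [|o5 [|]]]]]] //= eD _ un.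
rewrite Ee !big_cons big_nil addr0 !addrA => /esym dep.
have oZ o : o \in [:: o1; o2; o3; o4; o5] -> o \in zeros w.
  by rewrite eD => /(subsetP DZ).
have [||[z1 z2 z3 z4 z5]|] := card_zeros_five_dep Uw un _ _ dep.
- by rewrite !oZ // !inE eqxx ?orbT.
- by rewrite !Ke.
- apply/ffunP => o; rewrite ffunE; have [oD|oD] := boolP (o \in D); last first.
    by apply/eqP; apply: contraR oD => eo; rewrite sD // inE.
  by move: oD; rewrite -eD !inE => /or4P[/eqP->|/eqP->|/eqP->|/orP[]/eqP->].
by rewrite cardZ; have := q_sqr; have := q_ge4; lia.
Qed.

Lemma pv_neq0 o : pv o != 0.
Proof.
apply/eqP; rewrite -vecU0 => /vecU_inj[].
by case: o => [t|] /=; rewrite nm1; [move=> /eqP | move=> _ _ _ /eqP]; rewrite oner_eq0.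
Qed.

Lemma pt_inj : injective pt.
Proof.
move=> o o' E; have : pv o \in pt o' by rewrite -E Kspan_mem ?mem_head.
case/KspanP => c Kc; rewrite big_ord1 /=; have := Kc ord0; move: (c ord0) => k Kk.
rewrite /pv /pvec vecU_Z //; case/vecU_inj; case: o o' {E c Kc} => [t|] [u|] //=.
- by rewrite !(nm1, frob1, mulr1) => <-; rewrite mul1r => ->.
- by rewrite nm1 nm0 mulr0 => /eqP; rewrite oner_eq0.
- by rewrite nm0 nm1 mulr1 => <- _ _; rewrite mul0r => /eqP; rewrite oner_eq0.
Qed.

Lemma O1E : O1 F q = pt @: setT.
Proof.
have E1 t : Pt q 1 t (t ^+ (q ^ 2 + q)) (t ^+ (q ^ 2 + q + 1)) = pt (Some t).
  have Ec : t ^+ (q ^ 2 + q) = s t * ss t by rewrite exprD frob2E mulrC.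
  have Ed : t ^+ (q ^ 2 + q + 1) = nm t by rewrite exprD expr1 Ec /nm mulrC mulrA.
  by rewrite Ed Ec /Pt /pt /pv /pvec /= nm1 !frob1 !mulr1.
have E2 : Pt q 0 0 0 1 = pt None.
  by rewrite /Pt /pt /pv /pvec /= nm0 nm1 !frob0 !(mulr0, mul0r).
apply/setP => P; rewrite in_setU in_set1; apply/orP/imsetP.
  by move=> [/imsetP[t _ ->]|/eqP->]; [exists (Some t) | exists None].
move=> [[t|] _ ->]; last by right; rewrite E2.
by left; apply/imsetP; exists t.
Qed.

Lemma pt_sub o A : Fq_closed A -> (pt o \subset A) = (pv o \in A).
Proof.
move=> clA; apply/idP/idP => [/subsetP-> //|Ao]; first by rewrite Kspan_mem ?mem_head.
by apply: Kspan_sub => // u; rewrite inE => /eqP->.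
Qed.

Lemma pts_in_H1 : pts_in (O1 F q) H1 = pt @: zeros w.
Proof.
apply/setP => P; rewrite inE O1E; apply/andP/imsetP => [[/imsetP[o _ ->]]|[o Zo ->]].
  by rewrite (pt_sub _ H1_closed) pv_H1 => Zo; exists o.
by rewrite imset_f // (pt_sub _ H1_closed) pv_H1.
Qed.

Lemma pts_in_sub A : Fq_closed A ->
  pts_in (pt @: zeros w) A = pt @: [set o in zeros w | pv o \in A].
Proof.
move=> clA; apply/setP => P; rewrite inE; apply/andP/imsetP.
  by move=> [/imsetP[o Zo ->]]; rewrite pt_sub // => Ao; exists o; rewrite // inE Zo.
by move=> [o /setIdP[Zo Ao] ->]; rewrite imset_f // pt_sub.
Qed.

Lemma pts_in_solid_le S : proj_subspace q S 3 ->
  (#|pts_in (pt @: zeros w) S| <= 4)%N.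
Proof.
move=> [[l [szl frl DS]] SU].
have clS : Fq_closed S by rewrite DS; apply: Kspan_closed.
rewrite pts_in_sub // card_imset; last exact: pt_inj.
rewrite leqNgt; apply/negP => /subset_of_card[D DZ D5].
have [||e De e0] := @word_exists _ pv D S clS.
- by move=> o /(subsetP DZ)/setIdP[].
- by rewrite D5 DS card_Kspan_free // szl expn_ltq.
case/negP: e0; apply/eqP; apply: (zeros_indep5 _ D5 De).
by apply: subset_trans DZ _; apply/subsetP => o /setIdP[].
Qed.

Lemma zeros_span S (k : nat) : proj_subspace q S k -> S \subset H1 ->
  (forall o, o \in zeros w -> pv o \in S) -> S = H1.
Proof.
move=> [[l [szl frl DS]] SU] SH ZS; apply/eqP; rewrite eqEcard SH cardH1 /=.
have cS : #|S| = (q ^ k.+1)%N by rewrite DS card_Kspan_free // szl.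
rewrite cS leqNgt; apply/negP => ltk.
have {}ltk : (k.+1 < 7)%N.
  by rewrite ltnNge; apply/negP => le7; move: ltk;
    rewrite ltnNge leq_exp2l ?le7 //; have := q_ge4; lia.
(* Requiring [g] to vanish also at a point where [w] does not ensures that [g] is no multiple of
   [w]; there is room for this since [l] has at most six vectors. *)
have [o0 o0w] := nonzero_form Uw w0.
have [||g Ug [g0 gP]] := @perp_exists (pv o0 :: l).
- by rewrite /= szl.
- move=> u; rewrite inE => /orP[/eqP->|ul]; first exact: pvec_U1.
  by apply: (subsetP SU); rewrite DS Kspan_mem.
have gZ o : o \in zeros w -> dot g (pv o) = 0.
  move=> /ZS; rewrite DS => /KspanP[c Kc ->]; rewrite dot_sum big1 // => i _.
  by rewrite gP ?mulr0 // inE mem_nth ?orbT.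
have go0 : dot g (pv o0) = 0 by rewrite gP ?mem_head.
(* Off the zeros of [w], each point is a zero of [g - c w] for exactly one [c], namely its ratio. *)
pose ratio o := dot g (pv o) / dot w (pv o).
have ratioK o : ratio o \in Fq by rewrite FqM ?FqV ?dot_Fq ?pvec_U1.
have fibre c : c \in Fq -> (#|[set o | ratio o == c] :\: zeros w| <= 2 * q)%N.
  move=> Kc; pose h := g + (- c) *: w.
  have Uh : h \in U1 F q by rewrite U1_D ?U1_Z ?FqN.
  have hE o : dot h (pv o) = dot g (pv o) - c * dot w (pv o).
    by rewrite dotDl dotZl mulNr.
  have h0 : h != 0.
    apply: contraNneq g0 => hz; have := hE o0; rewrite hz dotC dot0 go0 sub0r => /esym/eqP.
    rewrite oppr_eq0 mulf_eq0 (negPf o0w) orbF => /eqP c0.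
    by move: hz; rewrite /h c0 oppr0 scale0r addr0 => ->.
  have sub : zeros w :|: ([set o | ratio o == c] :\: zeros w) \subset zeros h.
    apply/subsetP => o; rewrite in_setU => /orP[Zo|].
      rewrite inE hE gZ //; move: Zo; rewrite inE => /eqP->.
      by rewrite mulr0 subrr.
    rewrite in_setD !inE => /andP[wo /eqP rc].
    by rewrite hE -rc divfK // subrr.
  have dis : zeros w :&: ([set o | ratio o == c] :\: zeros w) = set0.
    by apply/setP => o; rewrite in_setI in_setD in_set0; case: (o \in zeros w).
  have := leq_trans (subset_leq_card sub) (card_zeros Uh h0).
  rewrite cardsU dis cards0 cardZ; move: #|_ :\: _| => m.
  by have := q_sqr; have := q_ge4; clear; lia.
have cC : (#|~: zeros w| <= q * (2 * q))%N.
  rewrite -sum1_card (partition_big ratio (mem Fq)) /=; last by move=> o _; apply: ratioK.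
  rewrite -[X in (_ <= X * _)%N]cardFq -sum_nat_const; apply: leq_sum => c Kc.
  apply: leq_trans (fibre c Kc); rewrite sum1_card; apply/subset_leq_card/subsetP => o.
  by rewrite unfold_in /= !inE.
have := cardsC (zeros w); rewrite cardZ card_option cardF (expnS q 2).
(* The cover would give [q^3 - q^2 + q <= 2 q^2], false for [q >= 4]. *)
by move: cC; rewrite mulnCA mulnn; have := q_sqr; have := q_ge4; nia.
Qed.

Lemma six_dependent : exists2 D : {set option F}, D \subset zeros w &
  #|D| = 6%N /\ exists2 e, is_word pv D e & e != 0.
Proof.
have q2 := q_sqr; have q4 := q_ge4.
suff [e De [e0 e6]] : exists2 e, is_word pv (zeros w) e & e != 0 /\ (#|wsupp e| <= 6)%N.
  have /andP[/pffun_FqP[Ke sZ] Ee] := De.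
  (* Pad the support of a word of weight at most 6 to exactly six points. *)
  have [|C CZ cC] := @subset_of_card _ (zeros w :\: wsupp e) (6 - #|wsupp e|).
    by rewrite cardsD (setIidPr sZ) cardZ leq_sub2r //; lia.
  exists (wsupp e :|: C).
    by rewrite subUset sZ (subset_trans CZ) // subsetDl.
  split.
    rewrite cardsU cC (_ : _ :&: _ = set0) ?cards0 ?subn0 ?subnKC //.
    apply/setP => o; rewrite in_setI in_set0; apply/negP => /andP[oe /(subsetP CZ)].
    by rewrite in_setD oe.
  exists e => //; rewrite /is_word Ee andbT; apply/pffun_FqP; split=> //.
  exact: subsetUl.
have ZH : {in zeros w, forall o, pv o \in H1} by move=> o; rewrite pv_H1.
have [q5|q5] := leqP 5 q.
  by apply: (sphere_packing_word H1_closed ZH); rewrite cardH1 cardZ packing_bound.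
have {q5}q4' : q = 4%N by lia.
(* For [q = 4] the section has 13 points; the code is shortened to any ten of them. *)
have [|D DZ D10] := @subset_of_card _ (zeros w) 10; first by rewrite cardZ q4'.
have [/existsP[e /and3P[De e0 e6]]|nE] :=
    boolP [exists e : {ffun option F -> F}, [&& is_word pv D e, e != 0 & (#|wsupp e| <= 6)%N]].
  exists e => //; have /andP[/pffun_FqP[Ke sD] Ee] := De.
  by rewrite /is_word Ee andbT; apply/pffun_FqP; split=> //; apply: subset_trans sD DZ.
case: (@no_ten_arc _ pv D H1 q4' H1_closed cardH1 _ D10).
  by move=> o /(subsetP DZ)/ZH.
move=> e De e0; rewrite ltnNge; apply/negP => e6.
by case/negP: nE; apply/existsP; exists e; rewrite De e0.
Qed.

(** [Kfree] speaks of coefficients indexed by list positions, [is_word] of coefficients indexed by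
    points; the proof transports the former to the latter. *)
Lemma Kfree_enum (D : {set option F}) :
  (forall e, is_word pv D e -> e = 0) -> Kfree q [seq pv o | o <- enum D].
Proof.
move=> indD c Kc E i0.
have lt_sz (i : 'I_(size [seq pv o | o <- enum D])) : (i < size (enum D))%N.
  by rewrite -(size_map pv) ltn_ord.
pose o_ (i : 'I_(size [seq pv o | o <- enum D])) := nth None (enum D) i.
have o_inj : injective o_.
  by move=> i j /eqP; rewrite nth_uniq ?enum_uniq // => /eqP /val_inj.
pose e : {ffun option F -> F} := [ffun o => \sum_(i | o_ i == o) c i].
have eo i : e (o_ i) = c i.
  by rewrite ffunE (big_pred1 i) // => j; rewrite (inj_eq o_inj).
rewrite -eo (indD e) ?ffunE //; apply/andP; split.
  apply/pffun_FqP; split=> [o|].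
    rewrite ffunE; apply: (big_ind (fun x => x \in Fq)) => [|x y|i _]; first exact: Fq0.
      exact: FqD.
    by rewrite inE; apply: Kc.
  apply/subsetP => o; rewrite inE ffunE; apply: contraR => oD; rewrite big_pred0 // => i.
  by apply: contraNF oD => /eqP <-; rewrite -mem_enum mem_nth.
rewrite -E /combo; apply/eqP.
transitivity (\sum_o \sum_(i | o_ i == o) c i *: pv (o_ i)).
  apply: eq_bigr => o _; rewrite ffunE scaler_suml; apply: eq_bigr => i /eqP <- //.
rewrite [RHS](partition_big o_ xpredT) //=; apply: eq_bigr => o _.
by apply: eq_bigr => i _; rewrite (nth_map None).
Qed.

(** Among six dependent points drop one in the support of the relation. The other five are
    independent and span a 4-space, and solving the relation for the dropped point places it there
    as well. *)
Lemma six_points_in_4space : exists S, [/\ proj_subspace q S 4, S \subset H1 &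
  (6 <= #|pts_in (pt @: zeros w) S|)%N].
Proof.
have [D DZ [D6 [e De e0]]] := six_dependent.
have [o oe] : exists o, o \in wsupp e by apply/set0Pn; rewrite wsupp_eq0.
have /andP[/pffun_FqP[Ke sD] /eqP Ee] := De.
have oD : o \in D by apply: (subsetP sD).
pose C := D :\ o; have CD : C \subset D by apply: subsetDl.
have CZ : C \subset zeros w := subset_trans CD DZ.
have C5 : #|C| = 5%N by have := cardsD1 o D; rewrite oD D6 add1n => -[<-].
pose S := Kspan q [seq pv o | o <- enum C].
have clS : Fq_closed S by apply: Kspan_closed.
have CS o' : o' \in C -> pv o' \in S by move=> oC; apply/Kspan_mem/map_f; rewrite mem_enum.
have SH : S \subset H1.
  apply: Kspan_sub => [|u /mapP[o' + ->]]; first exact: H1_closed.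
  by rewrite mem_enum pv_H1 => /(subsetP CZ).
exists S; split=> //.
  split; last by apply: subset_trans SH _; rewrite DH1; apply/subsetP => u /setIdP[].
  exists [seq pv o | o <- enum C]; split=> //; first by rewrite size_map -cardE.
  by apply: Kfree_enum => e'; apply: zeros_indep5.
rewrite pts_in_sub // card_imset; last exact: pt_inj.
rewrite -[X in (X <= _)%N]D6; apply/subset_leq_card/subsetP => o' oD'; apply/setIdP.
split; first exact: (subsetP DZ).
have [->|no] := eqVneq o' o; last by apply: CS; rewrite !inE no.
rewrite inE in oe.
have -> : pv o = \sum_i (if i == o then 0 else - e i / e o) *: pv i.
  apply: (scalerI oe); rewrite scaler_sumr [RHS](bigD1 o) //= eqxx scale0r scaler0 add0r.
  move: Ee; rewrite /combo (bigD1 o) //= => /eqP; rewrite addr_eq0 => /eqP->.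
  rewrite -sumrN; apply: eq_bigr => i /negPf->.
  by rewrite scalerA mulrCA divff // mulr1 scaleNr.
apply: Fq_closed_sum => // i; first by case: eqP => _; rewrite ?Fq0 ?FqM ?FqN ?FqV.
case: (i =P o) => [_|/eqP io]; first by rewrite eqxx.
move=> ei; apply: CS; rewrite !inE io (subsetP sD) // inE.
by apply: contraNneq ei => ->; rewrite oppr0 mul0r.
Qed.

Lemma k_general5 : k_general q H1 (pts_in (O1 F q) H1) 5.
Proof.
rewrite pts_in_H1; split.
- move=> _ /imsetP[o Zo ->]; rewrite (pt_sub _ H1_closed) pv_H1; split=> //; split.
    exists [:: pv o]; split=> // c Kc; rewrite big_ord1 /= => /eqP.
    rewrite scaler_eq0 => /orP[/eqP c0 i|/eqP p0]; first by rewrite ord1.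
    by have := pv_neq0 o; rewrite p0 eqxx.
  by rewrite (pt_sub _ U1_closed) pvec_U1.
- by move=> S dS _; apply: pts_in_solid_le.
- move=> S k dS SH ZS; apply: (zeros_span dS SH) => o Zo.
  have [[l [_ _ DS]] _] := dS.
  by rewrite -pt_sub ?DS; [rewrite -DS ZS // imset_f | apply: Kspan_closed].
exact: six_points_in_4space.
Qed.

End Main.

End Cubic.

Theorem mainTheorem9 (F : finFieldType) (q : nat) :
  (exists p k : nat, prime p /\ q = (p ^ k.+1)%N) ->
  #|F| = (q ^ 3)%N -> (4 <= q)%N ->
  forall H1 : {set vec F}, @hyperplane F q H1 ->
  #|pts_in (O1 F q) H1| = (q ^ 2 - q + 1)%N ->
  @k_general F q H1 (pts_in (O1 F q) H1) 5.
Proof.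
move=> hq cF q4 H1 hH1; have [w Uw [w0 DH1]] := hyperplane_form hq cF q4 hH1.
rewrite (pts_in_H1 hq cF q4 DH1) card_imset; last exact: pt_inj.
move=> cZ; rewrite -(pts_in_H1 hq cF q4 DH1).
(* The cardinality [q^7] comes from the seven free vectors spanning the hyperplane. *)
apply: (k_general5 hq cF q4 Uw w0 DH1 _ cZ); have [[l [szl frl ->]] _] := hH1.
by rewrite card_Kspan_free // szl.
Qed.
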